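(* In each item, $Y\subseteq\mathsf{all}$ is such that the density numbers occurring in the item are defined. \begin{enumerate} \item If $\mathsf{osc}\in Y$, then $\mathfrak{dd}_{[0,1],Y}=\mathfrak{dd}_{\{0,1\},Y}=\mathrm{non}(\mathcal M)$. \item If $\mathsf{osc}\notin Y$, then $\mathfrak{dd}_{\mathsf{all},Y}=\mathfrak{dd}_{[0,1],Y}=\mathfrak{dd}_{\{0,1\},Y}=\mathfrak c$; also $\mathfrak{dd}_{\{\mathsf{osc}\},(0,1)}=\mathfrak c$. \item $\mathrm{cov}(\mathcal N)\le\mathfrak{dd}_{(0,1),\mathsf{all}}=\mathfrak{dd}_{(0,1),\{\mathsf{osc}\}}\le\min\{\mathfrak r,\mathrm{non}(\mathcal M)\}$. \item $\max\{\mathrm{cov}(\mathcal N),\mathrm{cov}(\mathcal M),\mathfrak b\}\le\mathfrak{dd}_{(0,1),[0,1]}$; moreover $\mathfrak{dd}_{(0,1),[0,1]}\le\mathfrak{dd}_{(0,1),(0,1)}\le\mathfrak r$ and $\mathfrak{dd}_{(0,1),[0,1]}\le\mathfrak{dd}_{(0,1),\{0,1\}}\le\mathfrak r$. \item $\max\{\mathfrak b,\mathrm{cov}(\mathcal M)\}\le\mathfrak{dd}_{\{\mathsf{osc}\},\mathsf{all}}=\mathfrak{dd}_{\{\mathsf{osc}\},[0,1]}\le\mathfrak{dd}_{\{\mathsf{osc}\},\{0,1\}}\le\mathfrak r$. \item $\max\{\mathrm{non}(\mathcal M),\mathrm{cov}(\mathcal M)\}\le\mathfrak{dd}_{\mathsf{all},\mathsf{all}}=\max\{\mathrm{non}(\mathcal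 M),\mathfrak{dd}_{\{\mathsf{osc}\},\mathsf{all}}\}\le\max\{\mathrm{non}(\mathcal M),\mathfrak r\}$. \end{enumerate}
   Context: $n\in\omega$ is identified with $\{0,\dots,n-1\}$. For $A\subseteq\omega$, $\underline d(A)=\liminf_n|A\cap n|/n$ and $\overline d(A)=\limsup_n|A\cap n|/n$; if they are equal, $d(A)$ denotes the common value; if $\underline d(A)<\overline d(A)$, write $d(A)=\mathsf{osc}$, where $\mathsf{osc}$ is a formal symbol. $\mathsf{all}=[0,1]\cup\{\mathsf{osc}\}$. $\mathrm{Sym}(\omega)$ is the set of permutations of $\omega$. For $X,Y\subseteq\mathsf{all}$ such that $X\ne\emptyset$ and for all $x\in X$ there is $y\in Y$ with $y\ne x$, the $(X,Y)$-density number $\mathfrak{dd}_{X,Y}$ is defined as the smallest cardinality of a family $\Pi\subseteq\mathrm{Sym}(\omega)$ such that for every infinite-coinfinite $A\subseteq\omega$ with $d(A)\in X$ there is $\pi\in\Pi$ such that $d(\pi[A])\in Y$ and $d(\pi[A])\ne d(A)$. (For other pairs $X,Y$ it is not defined.) $\mathcal M$ and $\mathcal N$ are the meager and null ideals on $2^\omega$; $\mathrm{non}(\mathcal I)$ is the least size of a subset of $2^\omega$ not in $\mathcal I$ and $\mathrm{cov}(\mathcal I)$ the least size of a subfamily of $\mathcal I$ covering $2^\omega$. $\mathfrak b$ is the unbounding number (least size of a $\le^*$-unbounded family in $\omega^\omega$), $\mathfrak r$ is the reaping number (least size of a family $\mathcal R\subseteq[\omega]^\omega$ such that for every $A\in[\omega]^\omega$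 there is $B\in\mathcal R$ with $B\subseteq^*A$ or $B\cap A$ finite), $\mathfrak c=2^{\aleph_0}$. *)

(* Defs.v *)
From HB Require Import structures.
From mathcomp Require Import all_boot all_order all_algebra.
From mathcomp Require Import all_classical all_reals all_analysis.

Set Implicit Arguments.
Unset Strict Implicit.
Unset Printing Implicit Defensive.

Import Order.TTheory GRing.Theory Num.Theory.

Local Open Scope classical_set_scope.
Local Open Scope ring_scope.
Local Open Scope card_scope.

(* A cardinal number is an equipotence class of types; since propositions are
   extensional, Leibniz equality of cardinals is equality of cardinalities. *)
Definition equipotence_class (X : Type) : set Type :=
  [set Y | [set: Y] #= [set: X]].

Definition cardinal : Type :=
  {C : set Type | exists X : Type, C = equipotence_class X}.

HB.instance Definition _ := gen_eqMixin cardinal.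
HB.instance Definition _ := gen_choiceMixin cardinal.

Definition card (T : Type) (A : set T) : cardinal :=
  exist _ (equipotence_class {x : T | A x}) (ex_intro _ {x : T | A x} erefl).

Lemma card_sig (T : Type) (A : set T) : [set: {x : T | A x}] #= A.
Proof.
have rA : @sval T A @` [set: {x : T | A x}] = A.
  by apply/seteqP; split=> [_ [[x Ax] _ <-]//|x Ax]; exists (exist _ x Ax).
rewrite card_eq_sym -[X in X #= _]rA; apply: inj_card_eq.
by move=> -[x Ax] [y Ay] _ _ /= xy; exact: eq_exist.
Qed.

Definition card_repr (c : cardinal) : Type := projT1 (cid (projT2 c)).

Lemma card_repr_eq (c d : cardinal) :
  [set: card_repr c] #= [set: card_repr d] -> c = d.
Proof.
rewrite /card_repr; case: (cid _) => X /= eX; case: (cid _) => Y /= eY XY.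
suff : sval c = sval d.
  by case: c d {eX eY} => [C hC] [D hD] /= CD; exact: eq_exist.
rewrite eX eY /equipotence_class.
by apply/seteqP; split=> Z /= ZX; [exact: card_eq_trans ZX XY|];
   apply: card_eq_trans ZX _; rewrite card_eq_sym.
Qed.

Lemma card_reprK (T : Type) (A : set T) : [set: card_repr (card A)] #= A.
Proof.
rewrite /card_repr; case: (cid _) => X /= eX.
have : equipotence_class {x : T | A x} {x : T | A x} by exact: card_eqxx.
rewrite eX /equipotence_class /= card_eq_sym => XA.
exact: card_eq_trans XA (card_sig A).
Qed.

Definition cardinal_le (c d : cardinal) : bool :=
  [set: card_repr c] #<= [set: card_repr d].

Lemma cardinal_le_refl : reflexive cardinal_le.
Proof. by move=> c; exact: card_lexx. Qed.

Lemma cardinal_le_anti : antisymmetric cardinal_le.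
Proof. by move=> c d cd; apply: card_repr_eq; rewrite card_eq_le. Qed.

Lemma cardinal_le_trans : transitive cardinal_le.
Proof. by move=> d c e; exact: card_le_trans. Qed.

HB.instance Definition _ := Order.Le_isPOrder.Build Order.default_display
  cardinal cardinal_le_refl cardinal_le_anti cardinal_le_trans.

Lemma cardinal_leE (T U : Type) (A : set T) (B : set U) :
  (card A <= card B)%O = (A #<= B).
Proof.
by rewrite [LHS](card_le_eql (card_reprK A)) (card_le_eqr (card_reprK B)).
Qed.

Lemma cardinal_eqP (T U : Type) (A : set T) (B : set U) :
  card A = card B <-> A #= B.
Proof.
split=> [AB|AB].
  have := card_reprK A; rewrite AB card_eq_sym => A'.
  exact: card_eq_trans A' (card_reprK B).
by apply/eqP; rewrite eq_le !cardinal_leE -card_eq_le.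
Qed.

Lemma ex_least_cardinal (C : set cardinal) :
  C !=set0 -> exists c, C c /\ lbound C c.
Proof.
move=> [c0 Cc0]; pose I := {c | C c}; pose X (i : I) := card_repr (sval i).
pose P (S : set (forall i, X i)) :=
  forall f g, S f -> S g -> forall i, f i = g i -> f = g.
have [F FP Ftot|S [PS Smax]] := @Zorn_bigcup _ P.
  move=> f g [A FA Af] [B FB Bg] i; case: (Ftot _ _ FA FB) => AB.
    by apply: (FP _ FB) => //; exact: AB.
  by apply: (FP _ FA) => //; exact: AB.
have [[i iS]|nS] := pselect (exists i, forall x, exists2 f, S f & f i = x).
  exists (sval i); split=> [|d Cd]; first exact: (svalP i).
  pose j : I := exist _ d Cd.
  have /choice[s sS] x : exists f, S f /\ f i = x by have [f] := iS x; exists f.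
  suff [h] : $|{injfun [set: X i] >-> [set: X j]}| by exact: inj_card_le h.
  apply/injfunPex; exists (fun x => s x j) => // x y _ _ sxy.
  have [Sx <-] := sS x; have [Sy <-] := sS y.
  by rewrite (PS _ _ Sx Sy j sxy).
have exS i : exists x : X i, forall f, S f -> f i <> x.
  apply/not_existsP => Sx; apply: nS; exists i => x.
  by have /existsNP[f /not_implyP[Sf /contrapT fx]] := Sx x; exists f.
pose x i := sval (cid (exS i)).
have xS i f : S f -> f i <> x i by exact: (svalP (cid (exS i))).
exfalso; apply: (Smax (S `|` [set x])).
  split; first exact: subsetUl.
  by move=> /(_ x (or_intror erefl)) /(xS (exist _ c0 Cc0)).
move=> f g [Sf|->] [Sg|->] // i fg; first exact: PS fg.
  by case: (xS i f Sf).
by case: (xS i g Sg).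
Qed.

Lemma cardinal_le_total : total (<=%O : rel cardinal).
Proof.
move=> c d; have [|m [[->|->] lbm]] := @ex_least_cardinal [set c; d].
- by exists c; left.
- by rewrite (lbm d)//; right.
- by rewrite (lbm c) ?orbT//; left.
Qed.

HB.instance Definition _ :=
  Order.POrder_isTotal.Build Order.default_display cardinal cardinal_le_total.

(* By leastP, the default value matters only when C is empty. *)
Definition least (C : set cardinal) : cardinal :=
  xget (card (@set0 unit)) [set c | C c /\ lbound C c].

Lemma leastP (C : set cardinal) : C !=set0 -> C (least C) /\ lbound C (least C).
Proof. by move=> /ex_least_cardinal; exact: xgetPex. Qed.

Definition least_size (T : Type) (P : set (set T)) : cardinal :=
  least [set card F | F in P].

Definition continuum : cardinal := card [set: nat -> bool].

Definition nowhere_dense (A : set cantor_space) : Prop :=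
  interior (closure A) = set0.

Definition meager : set (set cantor_space) :=
  [set A | exists F : (set cantor_space)^nat,
    (forall k, nowhere_dense (F k)) /\ A = \bigcup_k F k].

Definition cylinder (s : seq bool) : set cantor_space :=
  [set x | forall i, (i < size s)%N -> x i = nth false s i].

(* The outer measure of the fair-coin product measure on Cantor space, which
   gives the cylinder of s measure 2 ^- size s. *)
Definition coin_outer_measure (R : realType) (A : set cantor_space) : \bar R :=
  ereal_inf [set (\sum_(0 <= k <oo) ((2^-1 : R) ^+ size (s k))%:E)%E |
    s in [set s : nat -> seq bool | A `<=` \bigcup_k cylinder (s k)]].

Definition null (R : realType) : set (set cantor_space) :=
  [set A | coin_outer_measure R A = 0%E].

Definition non (I : set (set cantor_space)) : cardinal :=
  least_size [set S : set cantor_space | ~ I S].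

Definition cov (I : set (set cantor_space)) : cardinal :=
  least_size [set F : set (set cantor_space) |
    F `<=` I /\ \bigcup_(A in F) A = [set: cantor_space]].

Definition le_star (f g : nat -> nat) : Prop :=
  \forall n \near \oo, (f n <= g n)%N.

Definition unbounding_number : cardinal :=
  least_size [set F : set (nat -> nat) |
    ~ exists g, forall f, F f -> le_star f g].

Definition reaping_number : cardinal :=
  least_size [set F : set (set nat) |
    (forall B, F B -> infinite_set B) /\
    forall A, infinite_set A -> exists2 B, F B &
      finite_set (B `\` A) \/ finite_set (B `&` A)].

Section DensityNumbers.
Variable R : realType.

(* The value at n = 0 is the junk 0 / 0 = 0, irrelevant for the limits. *)
Definition frequency (A : set nat) (n : nat) : R :=
  #|[pred i : 'I_n | (i : nat) \in A]|%:R / n%:R.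

Definition lower_density (A : set nat) : R := limn_inf (frequency A).

Definition upper_density (A : set nat) : R := limn_sup (frequency A).

(* None encodes osc, and Some r the real number r. *)
Definition osc : option R := None.

Definition density (A : set nat) : option R :=
  if lower_density A == upper_density A then Some (lower_density A) else osc.

Definition Icc01 : set (option R) := [set Some x | x in `[0, 1]].

Definition Ioo01 : set (option R) := [set Some x | x in `]0, 1[].

Definition ends01 : set (option R) := [set Some 0; Some 1].

Definition all_densities : set (option R) := Icc01 `|` [set osc].

Definition Sym : set (nat -> nat) := [set p | bijective p].

Definition dd_defined (X Y : set (option R)) : Prop :=
  [/\ X `<=` all_densities, Y `<=` all_densities, X !=set0 &
      forall x, X x -> exists2 y, Y y & y <> x].

(* Meaningful only when dd_defined X Y holds. *)
Definition dd (X Y : set (option R)) : cardinal :=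
  least_size [set P : set (nat -> nat) | P `<=` Sym /\
    forall A : set nat, infinite_set A -> infinite_set (~` A) ->
      X (density A) ->
      exists2 p, P p & Y (density (p @` A)) /\ density (p @` A) <> density A].

End DensityNumbers.

Arguments osc : clear implicits.
Arguments Icc01 : clear implicits.
Arguments Ioo01 : clear implicits.
Arguments ends01 : clear implicits.
Arguments all_densities : clear implicits.

(* Main.v *)
Require Import Defs.
From mathcomp Require Import all_boot all_order all_algebra.
From mathcomp Require Import all_classical all_reals all_analysis.
From mathcomp Require Import zify lra.

(** Every inequality is proved by turning a family that witnesses one cardinal
    into a family, of at most the same size, that witnesses another. Six
    constructions suffice.

    Shuffles. For infinite coinfinite B and C, let [shuffle B C] be the
    permutation that maps B increasingly onto C and the complement onto the
    complement. If C is the complement of the squares, then the image of A has,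
    up to a set of density zero, the relative density of A in B. For a generic
    set B there are long intervals on which B agrees with A and long intervals on
    which it agrees with the complement of A, so the image oscillates: a nonmeager
    set of sequences yields permutations that make all densities oscillate
    ([dd_le_non_meager]). For a member B of a reaping family, A almost contains B
    or almost misses it, so the image has density 0 or 1; with the evens in place
    of C and a sparse B, a density r becomes r/2 or (1+r)/2 ([dd_le_reaping],
    [shuffle_evens_image]).

    Stretches. If x contains and misses sufficiently long intervals infinitely
    often, then x and its image under a given permutation p oscillate
    ([stretchy_image_osc]). Such an x also chooses one element from each pair
    {2n, 2n+1}; the chosen set has density 1/2, and on the long intervals its
    image under p looks alternately like the image of the evens and like that of
    the odds, so that the density of the image, if any, is both u and 1-u, where u
    is a cluster point of the frequencies of the image of the evens
    ([transversal_image]). Since a generic x is stretchy, and a function dominating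
    the required lengths also gives a stretchy x, cov(M) and b are lower bounds
    ([cov_meager_le], [unbounding_number_le]).

    Guessing. If P changes the density of every set of density zero, then for each g some p in P has
    p(g(n)) < n^2 or g(n) < n^2 infinitely often, since otherwise the range of g
    and all its images have density zero. So the enumerations p^-1(0), 0, p^-1(1),
    1, ... capture every g infinitely often within 2 n^2 steps. Letting g(n) code
    more values of a function h than that, one can diagonalize through the
    enumeration so as to guess h itself at infinitely many points of any
    prescribed infinite set. Guessing first an interval partition, then words on
    its blocks, gives a nonmeager set indexed by pairs from P
    ([non_meager_le]); here one needs that P and its square have the same size.

    Almost disjointness. Under one permutation, at most countably many members of
    an almost disjoint family can get an image of positive density; hence
    families that turn densities into nonzero real numbers have size continuum
    ([continuum_le]).

    Large numbers. For each p, almost every x has an image of density 1/2 under p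
    ([large_numbers]), whence the lower bound cov(N).

    Alternation. If p changes the density of A from a to b, then a permutation
    that imitates in turn the identity and p, on a rapidly increasing sequence of
    finite sets, makes A oscillate ([alternation_osc]). It is built from p alone,
    so adding these permutations at most doubles an infinite family. *)

Set Implicit Arguments.
Unset Strict Implicit.
Unset Printing Implicit Defensive.

Import Order.TTheory GRing.Theory Num.Theory.
Import numFieldNormedType.Exports.
Local Open Scope classical_set_scope.

(** * Counting sets of natural numbers, and shuffles *)

Section Counting.

Definition cnt (A : set nat) n := count (fun i => i \in A) (iota 0 n).

Implicit Types A B C : set nat.

Lemma cntS A n : cnt A n.+1 = cnt A n + (n \in A).
Proof. by rewrite /cnt -addn1 iotaD count_cat /= addn0 add0n. Qed.

Lemma cnt0 A : cnt A 0 = 0. Proof. by []. Qed.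

Lemma cnt_le A n : cnt A n <= n.
Proof. by rewrite -[leqRHS](size_iota 0) count_size. Qed.

Lemma cntC A n : cnt A n + cnt (~` A) n = n.
Proof.
elim: n => // n IHn; rewrite !cntS in_setC; case: (n \in A) => /=; lia.
Qed.

Lemma cnt_mono A m n : m <= n -> cnt A m <= cnt A n.
Proof.
move=> mn; rewrite -(subnK mn); elim: (n - m) => [|k]; rewrite ?add0n//.
by rewrite addSn cntS; lia.
Qed.

Lemma cnt_near A B m n : (forall i, m <= i < n -> A i -> B i) ->
  cnt A n <= cnt B n + m.
Proof.
elim: n => [|n IHn] AB; first by rewrite cnt0.
have {}IHn : cnt A n <= cnt B n + m.
  by apply: IHn => i ?; apply: AB; lia.
have [mn|nm] := leqP m n; last by have := cnt_le A n.+1; lia.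
rewrite !cntS; case: (boolP (n \in A)) => [/set_mem An|_]; last by lia.
by rewrite (mem_set (AB n _ An)); lia.
Qed.

Lemma sub_cnt A B n : A `<=` B -> cnt A n <= cnt B n.
Proof. by move=> AB; rewrite -[leqRHS]addn0; apply: cnt_near => i _ /AB. Qed.

Lemma cntU A B n : cnt (A `|` B) n <= cnt A n + cnt B n.
Proof.
by elim: n => // n; rewrite !cntS in_setU; case: (_ \in A); case: (_ \in B) => /=; lia.
Qed.

Lemma cntID A B n : cnt A n = cnt (A `&` B) n + cnt (A `\` B) n.
Proof.
elim: n => // n; rewrite !cntS in_setI in_setD.
by case: (_ \in A); case: (_ \in B) => /=; lia.
Qed.

(** No element of B lies between two numbers below which B has equally many
    elements. *)
Lemma cnt_same A B m n : cnt B m = cnt B n -> cnt (A `&` B) m = cnt (A `&` B) n.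
Proof.
wlog mn : m n / m <= n => [H|].
  by have [mn|/ltnW nm] := leqP m n; [exact: H|move=> /esym /H ->].
rewrite (cntID B A m) (cntID B A n) ![B `&` A]setIC.
by have := cnt_mono (A `&` B) mn; have := cnt_mono (B `\` A) mn; lia.
Qed.

Lemma finite_cnt A : finite_set A -> exists K, forall i, A i -> i < K.
Proof.
move=> /finite_seqP[s ->]; exists (sumn s).+1 => i /= si.
by rewrite ltnS sumnE (big_rem i si) leq_addr.
Qed.

Lemma infinite_ge A : infinite_set A <-> forall k, exists2 i, k <= i & A i.
Proof.
split=> [iA k|Ak fA].
  have /infinite_setN0[i [Ai /negP]] := infinite_setD iA (finite_II k).
  by rewrite -leqNgt => ki; exists i.
by have [K AK] := finite_cnt fA; have [i Ki /AK] := Ak K; lia.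
Qed.

Lemma infinite_cnt A k : infinite_set A -> exists n, k <= cnt A n.
Proof.
move=> /infinite_ge iA; elim: k => [|k [n kn]]; first by exists 0.
have [i ni Ai] := iA n; exists i.+1.
by rewrite cntS (mem_set Ai); have := cnt_mono A ni; lia.
Qed.

(** The increasing enumeration of an infinite set A; the default value 0 is
    never taken then. *)
Definition elt (A : set nat) k : nat := xget 0 [set n | A n /\ cnt A n = k].

Lemma cnt_inj A m n : A m -> A n -> cnt A m = cnt A n -> m = n.
Proof.
wlog mn : m n / m <= n => [H|].
  by have [mn|/ltnW nm] := leqP m n; [exact: H|move=> *; exact/esym/H].
move=> Am An e; move: mn; rewrite leq_eqVlt => /orP[/eqP//|mn].
by have := cnt_mono A mn; rewrite cntS (mem_set Am); lia.
Qed.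

Lemma eltP A k : infinite_set A -> A (elt A k) /\ cnt A (elt A k) = k.
Proof.
move=> iA; apply: (xgetPex 0 (P := [set n | A n /\ cnt A n = k])).
have ex : exists n, k < cnt A n by have [n] := infinite_cnt k.+1 iA; exists n.
case: (ex_minnP ex) => -[//|n]; rewrite cntS => kn nmin.
have nk : cnt A n <= k by rewrite leqNgt; apply/negP => /nmin; lia.
exists n; case: (boolP (n \in A)) kn => [/set_mem An|_]; last by lia.
by split=> //; lia.
Qed.

Lemma elt_cnt A n : A n -> infinite_set A -> elt A (cnt A n) = n.
Proof. by move=> An iA; have [Ae] := eltP (cnt A n) iA; exact: cnt_inj. Qed.

Lemma elt_ge A k : infinite_set A -> k <= elt A k.
Proof. by move=> /(eltP k)[_ {1}<-]; exact: cnt_le. Qed.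

(** Both pieces are mapped increasingly, so that counting an image amounts to
    counting in an initial segment of the source. *)
Definition shuffle (B C : set nat) (a : nat) : nat :=
  if a \in B then elt C (cnt B a) else elt (~` C) (cnt (~` B) a).

Definition moiety (A : set nat) := infinite_set A /\ infinite_set (~` A).

Lemma moietyC A : moiety A -> moiety (~` A).
Proof. by move=> [iA iA']; split=> //; rewrite setCK. Qed.

Lemma shuffleK B C : moiety B -> moiety C -> cancel (shuffle B C) (shuffle C B).
Proof.
move=> [iB iB'] [iC iC'] a; rewrite /shuffle.
case: (boolP (a \in B)) => [/set_mem Ba|/negP Ba].
  by have [Ce ce] := eltP (cnt B a) iC; rewrite mem_set// ce elt_cnt.
have [Ce ce] := eltP (cnt (~` B) a) iC'.
by rewrite memNset// ce elt_cnt//= => ?; apply: Ba; exact: mem_set.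
Qed.

Lemma shuffle_bij B C : moiety B -> moiety C -> bijective (shuffle B C).
Proof. by move=> mB mC; exists (shuffle C B); exact: shuffleK. Qed.

Lemma image_can (p q : nat -> nat) A : cancel p q -> cancel q p ->
  p @` A = q @^-1` A.
Proof.
move=> pq qp; apply/seteqP; split=> [_ [a Aa <-] /=|a /= Aa]; first by rewrite pq.
by exists (q a) => //; rewrite qp.
Qed.

Lemma image_setC (p : nat -> nat) A : bijective p -> p @` (~` A) = ~` (p @` A).
Proof. by move=> [q pq qp]; rewrite !(image_can _ pq qp). Qed.

Lemma bij_imageI (p : nat -> nat) A B : bijective p ->
  p @` (A `&` B) = p @` A `&` p @` B.
Proof. by move=> [q pq qp]; rewrite !(image_can _ pq qp). Qed.

Lemma shuffle_image B C : moiety B -> moiety C -> shuffle B C @` B = C.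
Proof.
move=> mB mC; rewrite (image_can _ (shuffleK mB mC) (shuffleK mC mB)).
have [[iB iB'] [iC iC']] := (mB, mC).
apply/seteqP; split=> a /=; rewrite /shuffle.
  case: (boolP (a \in C)) => [/set_mem//|_].
  by have [+ _] := eltP (cnt (~` C) a) iB'.
by move=> /mem_set ->; have [] := eltP (cnt C a) iB.
Qed.

(** The elements of C below n are the images of the first elements of B, as
    many of them. *)
Lemma cnt_shuffleI A B C n N : moiety B -> moiety C -> cnt B N = cnt C n ->
  cnt (shuffle B C @` (A `&` B)) n = cnt (A `&` B) N.
Proof.
move=> mB mC; rewrite (image_can _ (shuffleK mB mC) (shuffleK mC mB)).
have [iB iB'] := mB.
elim: n N => [|n IHn] N BN.
  by rewrite cnt0; have := sub_cnt N (@subIsetr _ A B); rewrite BN cnt0; lia.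
rewrite cntS; move: BN; rewrite cntS.
case: (boolP (n \in C)) => [Cn|Cn] BN; last first.
  rewrite -(IHn N) ?BN ?addn0// memNset ?addn0// => -[_].
  rewrite /shuffle (negbTE Cn) => Be.
  by have [/(_ Be)] := eltP (cnt (~` C) n) iB'.
have [Be Ce] := eltP (cnt C n) iB; rewrite (IHn _ Ce).
have -> : cnt (A `&` B) N = cnt (A `&` B) (elt B (cnt C n)).+1.
  by apply: cnt_same; rewrite BN cntS Ce mem_set.
rewrite cntS; congr (_ + nat_of_bool _).
by apply/idP/idP => /set_mem H; apply/mem_set; move: H; rewrite /= /shuffle Cn.
Qed.

Lemma shuffleC B C : shuffle (~` B) (~` C) =1 shuffle B C.
Proof. by move=> a; rewrite /shuffle !setCK in_setC; case: (a \in B). Qed.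

Lemma cnt_shuffleD A B C n N : moiety B -> moiety C -> cnt (~` B) N = cnt (~` C) n ->
  cnt (shuffle B C @` (A `\` B)) n = cnt (A `\` B) N.
Proof.
move=> mB mC H; rewrite !setDE -(cnt_shuffleI A (moietyC mB) (moietyC mC) H).
by rewrite (_ : shuffle (~` B) (~` C) = shuffle B C)//; apply/funext/shuffleC.
Qed.

End Counting.

(** * The square of an infinite cardinal *)

Local Open Scope card_scope.

(** Comparison of cardinalities by total functions that are injective on a
    set; a point of the target serves as value elsewhere. *)
Lemma card_leP_fun (T U : Type) (u0 : U) (A : set T) (B : set U) :
  A #<= B <-> exists f : T -> U,
    (forall x, A x -> B (f x)) /\ forall x y, A x -> A y -> f x = f y -> x = y.
Proof.
split=> [/card_leP[g]|[f [fAB fI]]]; last first.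
  suff [h] : $|{injfun A >-> B}| by exact: inj_card_le h.
  by apply/injfunPex; exists f => // x y /set_mem Ax /set_mem Ay; exact: fI.
exists (fun x => if pselect (A x) is left Ax then set_val (g (SigSub (mem_set Ax)))
  else u0); split=> [x Ax|x y Ax Ay].
  by case: pselect => // Ax'; exact/set_mem/(valP (g _)).
case: pselect => // Ax'; case: pselect => // Ay' /val_inj /inj.
by rewrite !in_setE => /(_ I I)/(congr1 val).
Qed.

Section Squares.
Variable T : Type.
Implicit Types (S : set T) (f : T -> T -> T).

Definition pairing S f := (forall x y, S x -> S y -> S (f x y)) /\
  forall x y x' y', S x -> S y -> S x' -> S y' ->
    f x y = f x' y' -> x = x' /\ y = y'.

(** Partial binary operations are compared by inclusion of their graphs, which
    is the order to which the Zorn lemma is applied. *)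
Definition graph S f : set (T * T * T) :=
  [set p | [/\ S p.1.1, S p.1.2 & p.2 = f p.1.1 p.1.2]].

Lemma graph_sub S S' f f' : graph S f `<=` graph S' f' ->
  S `<=` S' /\ forall x y, S x -> S y -> f x y = f' x y.
Proof.
move=> G; split=> [x Sx|x y Sx Sy]; first by case: (G (x, x, f x x)).
by case: (G (x, y, f x y)).
Qed.

Lemma pairing_chain (F : set (set (T * T * T))) :
  (forall G, F G -> exists S f, pairing S f /\ G = graph S f) ->
  total_on F subset ->
  exists S f, pairing S f /\ \bigcup_(G in F) G = graph S f.
Proof.
move=> FP Ftot.
pose U := \bigcup_(G in F) G.
pose S := [set x : T | exists z : T, U (x, x, z)].
pose f (x y : T) := xget (x : {classic T}) [set z : {classic T} | U (x, y, z)].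
(* Finitely many points of S already live in a single member of the chain. *)
have S2 x y : S x -> S y -> exists S0 f0,
    [/\ F (graph S0 f0), pairing S0 f0, S0 x & S0 y].
  move=> [z [G FG Gx]] [w [H FH Hy]].
  have [S0 [f0 [p0 eG]]] := FP _ FG; have [S1 [f1 [p1 eH]]] := FP _ FH.
  have S0x : S0 x by move: Gx; rewrite eG => -[].
  have S1y : S1 y by move: Hy; rewrite eH => -[].
  have := Ftot _ _ FG FH; rewrite eG eH => -[] /graph_sub[s01 _].
    by exists S1, f1; split=> //; [rewrite -eH|exact: s01].
  by exists S0, f0; split=> //; [rewrite -eG|exact: s01].
have Uf S0 f0 x y z : F (graph S0 f0) -> S0 x -> S0 y -> U (x, y, z) -> z = f0 x y.
  move=> F0 S0x S0y [G FG]; have [S1 [f1 [p1 eG]]] := FP _ FG.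
  have := Ftot _ _ F0 FG; rewrite eG => -[] /graph_sub[s01 e01] [/= S1x S1y ->].
    by rewrite e01.
  by rewrite -e01.
have fE S0 f0 x y : F (graph S0 f0) -> S0 x -> S0 y -> f x y = f0 x y.
  move=> F0 S0x S0y; rewrite /f; apply: (Uf _ _ _ _ _ F0 S0x S0y).
  apply: (xgetPex (x : {classic T}) (P := [set z : {classic T} | U (x, y, z)])).
  by exists (f0 x y), (graph S0 f0).
have SS S0 f0 : F (graph S0 f0) -> S0 `<=` S.
  by move=> F0 x S0x; exists (f0 x x), (graph S0 f0).
exists S, f; split; [split|].
- move=> x y /S2 /[apply] -[S0 [f0 [F0 [p0 _] S0x S0y]]].
  by rewrite (fE _ _ _ _ F0)//; apply: SS F0 _ _; exact: p0.
- move=> x y x' y' /S2 /[apply] -[S0 [f0 [F0 [p0 i0] S0x S0y]]].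
  move=> /S2 /[apply] -[S1 [f1 [F1 [p1 i1] S1x S1y]]].
  have [/graph_sub[s _]|/graph_sub[s _]] := Ftot _ _ F0 F1.
    have [S1x2 S1y2] : S1 x /\ S1 y by split; exact: s.
    by rewrite !(fE _ _ _ _ F1)//; exact: i1.
  have [S0x2 S0y2] : S0 x' /\ S0 y' by split; exact: s.
  by rewrite !(fE _ _ _ _ F0)//; exact: i0.
apply/seteqP; split=> -[[x y] z] /=.
  move=> [G FG]; have [S0 [f0 [p0 eG]]] := FP _ FG.
  rewrite eG => -[/= S0x S0y ->]; rewrite eG in FG.
  by split=> /=; [exact: (SS _ _ FG _ S0x)|exact: (SS _ _ FG _ S0y)|rewrite (fE _ _ _ _ FG)].
move=> [/= Sx Sy ->]; have [S0 [f0 [F0 p0 S0x S0y]]] := S2 _ _ Sx Sy.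
by exists (graph S0 f0) => //; split=> //=; rewrite (fE _ _ _ _ F0).
Qed.

(** The pairings to be extended start from a countably infinite set, which
    keeps the maximal one from being finite. *)
Lemma pairing_nat (e : nat -> T) : injective e -> exists f, pairing (range e) f.
Proof.
move=> eI; pose g x := xget 0 [set n | e n = x].
have gK n : g (e n) = n.
  by apply: eI; apply: (xgetPex 0 (P := [set m | e m = e n])); exists n.
exists (fun x y => e (pickle (g x, g y))); split=> [x y _ _|]; first by eexists.
move=> _ _ _ _ [a _ <-] [b _ <-] [c _ <-] [d _ <-] /eI; rewrite !gK.
by move=> /(pcan_inj pickleK)[-> ->].
Qed.

(** A pairing of S makes room for the square of S and a disjoint copy of S:
    S plus its copy embed in S, so their square does too, and the new pairs are sent
    to the copy. *)
Lemma pairing_extend S f (h : T -> T) : pairing S f ->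
  (exists a b, [/\ S a, S b & a <> b]) ->
  (forall x, S x -> ~ S (h x)) ->
  (forall x y, S x -> S y -> h x = h y -> x = y) ->
  exists f', pairing (S `|` h @` S) f' /\ forall x y, S x -> S y -> f' x y = f x y.
Proof.
move=> [fS fI] [a [b [Sa Sb ab]]] hS hI.
pose g (x : T) := xget (x : {classic T}) [set y : {classic T} | S y /\ h y = x].
have gP x : (h @` S) x -> S (g x) /\ h (g x) = x.
  move=> [y Sy <-].
  by apply: (xgetPex (h y : {classic T}) (P := [set z : {classic T} | S z /\ h z = h y])); exists y.
(* c collapses S and its disjoint copy into S, tagging by a and b. *)
pose c x := if pselect (S x) then f x a else f (g x) b.
pose S' := S `|` h @` S.
have cS x : S' x -> S (c x).
  rewrite /c; case: pselect => Sx; first by move=> _; exact: fS.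
  by case=> // /gP[Sg _]; exact: fS.
have cI x y : S' x -> S' y -> c x = c y -> x = y.
  rewrite /c; case: pselect => Sx; case: pselect => Sy.
  - by move=> _ _ /(fI _ _ _ _ Sx Sa Sy Sa)[].
  - by move=> _ [//|/gP[Sg _]] /(fI _ _ _ _ Sx Sa Sg Sb)[].
  - by move=> [//|/gP[Sg _]] _ /(fI _ _ _ _ Sg Sb Sy Sa)[_ /esym].
  - move=> [//|/gP[Sgx hx]] [//|/gP[Sgy hy]] /(fI _ _ _ _ Sgx Sb Sgy Sb)[gxy _].
    by rewrite -hx -hy gxy.
pose f' x y := if pselect (S x /\ S y) then f x y else h (f (c x) (c y)).
have f'E x y : S x -> S y -> f' x y = f x y.
  by move=> Sx Sy; rewrite /f'; case: pselect => // -[].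
exists f'; split=> //; split=> [x y Sx Sy|x y x' y' Sx Sy Sx' Sy'].
  rewrite /f'; case: pselect => [[? ?]|?]; first by left; exact: fS.
  by right; exists (f (c x) (c y)) => //; apply: fS; exact: cS.
have Sf u v : S' u -> S' v -> S (f (c u) (c v)) by move=> *; apply: fS; exact: cS.
rewrite /f'; case: pselect => [[? ?]|?]; case: pselect => [[? ?]|?].
- by move=> /fI[].
- by move=> /= e; case: (hS _ (Sf _ _ Sx' Sy')); rewrite -e; exact: fS.
- by move=> /= e; case: (hS _ (Sf _ _ Sx Sy)); rewrite e; exact: fS.
- move=> /= /(hI _ _ (Sf _ _ Sx Sy) (Sf _ _ Sx' Sy')).
  by move=> /(fI _ _ _ _ (cS _ Sx) (cS _ Sy) (cS _ Sx') (cS _ Sy'))[/cI -> // /cI ->].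
Qed.

Lemma pairing_exists : infinite_set [set: T] -> exists f, pairing setT f.
Proof.
move=> /infiniteP iT; have [t0 _] : [set: T] !=set0.
  apply/set0P/negP => /eqP T0; move: iT; rewrite T0 card_le0 => /eqP/seteqP[+ _].
  by move=> /(_ 0); apply.
have [e [_ eI]] := (card_leP_fun t0 _ _).1 iT.
have [f0 p0] := pairing_nat (fun x y => eI x y I I).
pose P (G : set (T * T * T)) := (exists S f, pairing S f /\ G = graph S f) /\
  (G !=set0 -> graph (range e) f0 `<=` G).
have [F FP Ftot|G [[[S [f [pf ->]]] S0] Gmax]] := @Zorn_bigcup _ P.
  split; first by apply: pairing_chain => // G /FP[].
  move=> [x [G FG Gx]]; apply: (subset_trans _ (bigcup_sup FG)).
  by apply: (FP _ FG).2; exists x.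
have GS : graph (range e) f0 `<=` graph S f.
  have [GN0|/set0P/negP/negPn/eqP G0] := pselect (graph S f !=set0).
    exact: S0.
  exfalso; apply: (Gmax (graph (range e) f0)); last first.
    by split; [exists (range e), f0|move=> _; exact: subset_refl].
  rewrite G0; split=> // /(_ (e 0, e 0, f0 (e 0) (e 0))); apply.
  by split=> //=; exists 0.
have [eS _] := graph_sub GS.
have ab : exists a b, [/\ S a, S b & a <> b].
  exists (e 0), (e 1); split; [by apply: eS; exists 0|by apply: eS; exists 1|].
  by move=> /(eI _ _ I I).
have [a [b [Sa Sb nab]]] := ab.
(* By maximality the complement of S is no larger than S. *)
have /(card_leP_fun t0)[g [gS gI]] : ~` S #<= S.
  rewrite -cardinal_leE leNgt; apply/negP => /ltW; rewrite cardinal_leE.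
  move=> /(card_leP_fun t0)[h [hS hI]].
  have [f' [pf' f'E]] := pairing_extend pf ab hS hI.
  have GG : graph S f `<=` graph (S `|` h @` S) f'.
    by move=> [[x y] z] [/= Sx Sy ->]; split=> /=; [left|left|rewrite f'E].
  apply: (Gmax (graph (S `|` h @` S) f')); last first.
    split; first by exists (S `|` h @` S), f'.
    by move=> _; exact: subset_trans GS GG.
  split=> // /(_ (h a, h a, f' (h a) (h a)))[] /=.
    by split=> //; right; exists a.
  by move=> /(hS _ Sa).
(* Hence T injects into S, and S is in bijection with its square. *)
pose c x := if pselect (S x) then f x a else f (g x) b.
have cS x : S (c x) by rewrite /c; case: pselect => Sx; apply: pf.1 => //; exact: gS.
have cI x y : c x = c y -> x = y.
  rewrite /c; case: pselect => Sx; case: pselect => Sy.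
  - by move=> /(pf.2 _ _ _ _ Sx Sa Sy Sa)[].
  - by move=> /(pf.2 _ _ _ _ Sx Sa (gS _ Sy) Sb)[].
  - by move=> /(pf.2 _ _ _ _ (gS _ Sx) Sb Sy Sa)[_ /esym].
  - by move=> /(pf.2 _ _ _ _ (gS _ Sx) Sb (gS _ Sy) Sb)[/gI -> //].
exists (fun x y => f (c x) (c y)); split=> // x y x' y' _ _ _ _.
by move=> /(pf.2 _ _ _ _ (cS _) (cS _) (cS _) (cS _))[/cI -> /cI ->].
Qed.
End Squares.

(** The pairing exists on types; a set is replaced by its subtype. *)
Lemma infinite_pairing T (C : set T) : infinite_set C ->
  exists f : T -> T -> T, pairing C f.
Proof.
move=> iC; have [c0 Cc0] := infinite_setN0 iC.
have /pairing_exists[f [_ fI]] : infinite_set [set: sig C].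
  by rewrite (eq_finite_set (Defs.card_sig C)).
pose g x : sig C := if pselect (C x) is left Cx then exist _ x Cx else exist _ c0 Cc0.
have gK x : C x -> sval (g x) = x by rewrite /g; case: pselect.
exists (fun x y => sval (f (g x) (g y))); split=> [x y _ _|]; first exact: svalP.
have sI (u v : sig C) : sval u = sval v -> u = v.
  by case: u v => [u Cu] [v Cv] /= uv; exact: eq_exist.
move=> x y x' y' Cx Cy Cx' Cy' /sI/fI[]//.
by move=> /(congr1 sval) + /(congr1 sval); rewrite !gK.
Qed.

Lemma card_square T (C : set T) : infinite_set C -> C `*` C #<= C.
Proof.
move=> iC; have [f [fC fI]] := infinite_pairing iC.
have [c0 Cc0] := infinite_setN0 iC.
apply/(card_leP_fun c0); exists (fun p => f p.1 p.2).
split=> [[x y] [Cx Cy]|[x y] [x' y'] [/= Cx Cy] [/= Cx' Cy']]; first exact: fC.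
by move=> /(fI _ _ _ _ Cx Cy Cx' Cy')[-> ->].
Qed.

(** Two points of C tag the two parts. *)
Lemma card_setU_le T U (P Q : set T) (C : set U) : infinite_set C ->
  P #<= C -> Q #<= C -> P `|` Q #<= C.
Proof.
move=> iC; have [c0 Cc0] := infinite_setN0 iC.
have [f [fC fI]] := infinite_pairing iC.
have [c1 [Cc1 c01]] := infinite_setN0 (infinite_setD iC (finite_set1 c0)).
move=> /(card_leP_fun c0)[g [gC gI]] /(card_leP_fun c0)[h [hC hI]].
apply/(card_leP_fun c0).
exists (fun x => if pselect (P x) then f (g x) c0 else f (h x) c1).
split=> [x PQx|x y PQx PQy].
  case: pselect => Px; apply: fC => //; first exact: gC.
  by case: PQx => // /hC.
have Qh z : ~ P z -> (P `|` Q) z -> Q z by move=> ? [].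
case: pselect => Px; case: pselect => Py.
- by move=> /(fI _ _ _ _ (gC _ Px) Cc0 (gC _ Py) Cc0)[/gI ->].
- by move=> /(fI _ _ _ _ (gC _ Px) Cc0 (hC _ (Qh _ Py PQy)) Cc1)[_ /esym].
- by move=> /(fI _ _ _ _ (hC _ (Qh _ Px PQx)) Cc1 (gC _ Py) Cc0)[_].
- by move=> /(fI _ _ _ _ (hC _ (Qh _ Px PQx)) Cc1 (hC _ (Qh _ Py PQy)) Cc1)[/hI -> //];
    exact: Qh.
Qed.

(** A point is determined by its image and its rank in the countable fiber. *)
Lemma card_le_countable_fibers T U (A : set T) (C : set U) (F : T -> U) :
  infinite_set C -> (forall x, A x -> C (F x)) ->
  (forall u, countable (A `&` F @^-1` [set u])) -> A #<= C.
Proof.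
move=> iC FC Fc; have [c0 Cc0] := infinite_setN0 iC.
have /choice[g gI] u : exists g : T -> nat, {in A `&` F @^-1` [set u] &, injective g}.
  exact/countable_injP.
have [f [fC fI]] := infinite_pairing iC.
have /infiniteP/(card_leP_fun c0)[e [eC eI]] := iC.
apply/(card_leP_fun c0); exists (fun x => f (F x) (e (g (F x) x))).
split=> [x Ax|x y Ax Ay]; first by apply: fC; [exact: FC|exact: eC].
move=> /(fI _ _ _ _ (FC _ Ax) (eC _ I) (FC _ Ay) (eC _ I))[Fxy /(eI _ _ I I)].
by rewrite -Fxy; apply: gI; rewrite inE.
Qed.

(** * Density *)

Section Density.
Local Open Scope ring_scope.
Variable R : realType.
Implicit Types (A B : set nat) (r : R).

(** Multiplying by n keeps all the estimates free of divisions. *)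
Definition has_density A r := forall e, 0 < e -> exists K, forall n, (K <= n)%N ->
  `|(cnt A n)%:R - r * n%:R| <= e * n%:R.

Lemma frequencyE A n : frequency R A n = (cnt A n)%:R / n%:R.
Proof.
rewrite /frequency; congr (_%:R / _); rewrite cardE size_filter /cnt.
by rewrite -[in RHS]val_enum_ord count_map enumT; apply: eq_count.
Qed.

Lemma frequency_bounds A n : 0 <= frequency R A n <= 1.
Proof.
rewrite frequencyE divr_ge0 //=; case: n => [|n]; first by rewrite invr0 mulr0.
by rewrite ler_pdivrMr// mul1r ler_nat cnt_le.
Qed.

Lemma has_density_cvg A r : has_density A r <-> frequency R A @ \oo --> r.
Proof.
have E n : (0 < n)%N -> `|r - frequency R A n| * n%:R = `|(cnt A n)%:R - r * n%:R|.
  move=> n0; rewrite frequencyE -{2}[n%:R]ger0_norm// -normrM distrC mulrBl.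
  by rewrite divfK ?pnatr_eq0 -?lt0n.
split=> [dA|/cvgrPdist_le dA e e0].
  apply/cvgrPdist_le => e /dA[K Kn]; exists K.+1 => // n /= ?.
  by rewrite -(@ler_pM2r _ n%:R) ?E ?Kn ?ltr0n//; lia.
have [K _ Kn] := dA _ e0; exists K.+1 => n ?.
by rewrite -E; [rewrite ler_pM2r ?ltr0n ?Kn//=; lia|lia].
Qed.

(** When the lower and upper densities agree, the frequencies are squeezed
    between the infima and the suprema of their tails. *)
Lemma densityP A r : density R A = Some r <-> has_density A r.
Proof.
split=> [|/has_density_cvg /cvg_limn_inf_sup[+ +]]; last first.
  by rewrite /density /lower_density /upper_density => -> ->; rewrite eqxx.
rewrite /density; case: eqP => // lu [lr]; apply/has_density_cvg.
have bA : bounded_fun (frequency R A).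
  by exists 1; split=> // M M1 n _; have /andP[? ?] := frequency_bounds A n;
     rewrite /= ger0_norm//; lra.
have [ubA lbA] := (bounded_fun_has_ubound bA, bounded_fun_has_lbound bA).
have li : limn_inf (frequency R A) = sup (range (infs (frequency R A))).
  exact: limn_infE.
have ls : limn_sup (frequency R A) = inf (range (sups (frequency R A))).
  exact: limn_supE.
have le n : infs (frequency R A) n <= frequency R A n <= sups (frequency R A) n.
  apply/andP; split.
    by apply: ge_inf; [exact: has_lbound_sdrop|exists n => /=].
  by apply: ub_le_sup; [exact: has_ubound_sdrop|exists n => /=].
apply: (@squeeze_cvgr _ _ _ _ (infs (frequency R A)) (sups (frequency R A))).
- exact: nearW.
- by rewrite -lr /lower_density li; exact: cvg_infs_sup.
- by rewrite -lr lu /upper_density ls; exact: cvg_sups_inf.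
Qed.

Lemma density_oscP A : density R A = osc R <-> forall r, ~ has_density A r.
Proof.
split=> [Ao r /densityP|Ar]; first by rewrite Ao.
by case E: (density R A) => [r|//]; move/densityP: E => /Ar.
Qed.

Lemma has_density_uniq A r s : has_density A r -> has_density A s -> r = s.
Proof. by move=> /densityP Ar /densityP; rewrite Ar => -[]. Qed.

Lemma has_density_itv A r : has_density A r -> 0 <= r <= 1.
Proof.
move=> Ar; have [r0|r0] := ltP r 0.
  have [|K /(_ K.+1 (leqnSn _))] := Ar (- r / 2); first by lra.
  have k0 : 0 < K.+1%:R :> R by rewrite ltr0n.
  have c0 : 0 <= (cnt A K.+1)%:R :> R by [].
  by rewrite ler_norml => /andP[_]; nra.
have [r1|//] := ltP 1 r.
have [|K /(_ K.+1 (leqnSn _))] := Ar ((r - 1) / 2); first by lra.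
have k0 : 0 < K.+1%:R :> R by rewrite ltr0n.
have c0 : (cnt A K.+1)%:R <= K.+1%:R :> R by rewrite ler_nat cnt_le.
by rewrite ler_norml => /andP[+ _]; nra.
Qed.

Lemma natr_cntC A n : (cnt (~` A) n)%:R = n%:R - (cnt A n)%:R :> R.
Proof. by rewrite -{2}(cntC A n) natrD addrC addKr. Qed.

Lemma has_densityC A r : has_density A r -> has_density (~` A) (1 - r).
Proof.
move=> Ar e /Ar[K Kn]; exists K => n /Kn; rewrite natr_cntC.
by rewrite -normrN; congr (`|_| <= _); lra.
Qed.

Lemma sparse_small A (K : nat) r : has_density A 0 -> 0 < r ->
  exists N, forall n, (N <= n)%N -> (cnt A n)%:R + K%:R <= r * n%:R.
Proof.
move=> A0 r0; have [|N Nn] := A0 (r / 2); first by lra.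
exists (maxn N (Num.truncn (2 * K%:R / r)).+1) => n; rewrite geq_max => /andP[/Nn].
rewrite mul0r subr0 ger0_norm// => An Kn.
have : 2 * K%:R / r <= n%:R.
  by apply/ltW/(lt_le_trans (truncnS_gt _)); rewrite ler_nat.
by rewrite ler_pdivrMr//; lra.
Qed.

Lemma has_density0_le A B (K : nat) : has_density B 0 ->
  (forall n, (cnt A n <= cnt B n + K)%N) -> has_density A 0.
Proof.
move=> B0 AB e /(sparse_small K B0)[N Nn]; exists N => n /Nn h.
rewrite mul0r subr0 ger0_norm//; apply: le_trans h.
by rewrite -natrD ler_nat.
Qed.

(** The supremum of the numbers that are infinitely often below u is the
    limit superior of u. *)
Lemma cluster_point (u : nat -> R) : (forall n, 0 <= u n <= 1) ->
  exists l, forall e K, 0 < e -> exists2 n, (K <= n)%N & `|u n - l| <= e.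
Proof.
move=> u01; pose S := [set x | forall K, exists2 n, (K <= n)%N & x <= u n].
have S1 : ubound S 1.
  by move=> x /(_ 0%N)[n _] xu; have /andP[_] := u01 n; exact: le_trans.
have supS : has_sup S.
  split; last by exists 1.
  by exists 0 => K; exists K => //; have /andP[] := u01 K.
exists (sup S) => e K e0.
have [x Sx xe] := sup_adherent e0 supS.
have /existsNP[K' nK'] : ~ S (sup S + e).
  by move=> /(ub_le_sup supS.2); lra.
have [n nK xn] := Sx (maxn K K'); move: nK; rewrite geq_max => /andP[Kn K'n].
exists n => //; rewrite ler_norml; apply/andP; split; first by lra.
have /negP : ~ sup S + e <= u n by move=> h; apply: nK'; exists n.
by rewrite -ltNge; lra.
Qed.

(** A density would have to be at least 1 for the set and for its complement. *)
Lemma oscillates A :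
  (forall (e : R) K, 0 < e -> exists2 n, (K <= n)%N & (1 - e) * n%:R <= (cnt A n)%:R) ->
  (forall (e : R) K, 0 < e -> exists2 n, (K <= n)%N & (1 - e) * n%:R <= (cnt (~` A) n)%:R) ->
  density R A = osc R.
Proof.
move=> dA dA'; apply/density_oscP => r Ar.
have H (B : set nat) (s : R) : has_density B s -> (forall (e : R) K, 0 < e ->
  exists2 n, (K <= n)%N & (1 - e) * n%:R <= (cnt B n)%:R) -> 1 <= s.
  move=> Bs dB; rewrite leNgt; apply/negP => s1.
  have [|K Kn] := Bs ((1 - s) / 3); first by lra.
  have [|n nK] := dB ((1 - s) / 3) K.+1; first by lra.
  have := Kn n (ltnW nK); rewrite ler_norml => /andP[_].
  have : 0 < n%:R :> R by rewrite ltr0n; lia.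
  by nra.
by have := H _ _ Ar dA; have := H _ _ (has_densityC Ar) dA'; lra.
Qed.
End Density.

(** * Stretches, blocks and sparse sets *)

Lemma cnt_le_image (A : set nat) n (g : nat -> nat) N :
  (forall i, (i < n)%N -> A i -> exists2 k, (k < N)%N & i = g k) -> (cnt A n <= N)%N.
Proof.
move=> gA; pose s := map g (iota 0 N); have <- : size s = N by rewrite size_map size_iota.
rewrite /cnt -size_filter; apply: uniq_leq_size => [|i].
  by apply: filter_uniq; exact: iota_uniq.
rewrite mem_filter mem_iota add0n => /andP[/set_mem Ai /gA/(_ Ai)[k kN ->]].
by apply: map_f; rewrite mem_iota.
Qed.

Definition long_in (F : nat -> nat) (x : set nat) :=
  forall K, exists2 m, (K <= m)%N & forall i, (m <= i < F m)%N -> x i.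

Definition stretchy F x := long_in F x /\ long_in F (~` x).

Lemma long_in_infinite F x : (forall m, m < F m)%N -> long_in F x -> infinite_set x.
Proof.
by move=> Fm xF; apply/infinite_ge => k; have [m km mF] := xF k; exists m => //;
   apply: mF; rewrite leqnn /=.
Qed.

Lemma stretchy_moiety F x : (forall m, m < F m)%N -> stretchy F x -> moiety x.
Proof. by move=> Fm [? ?]; split; exact: long_in_infinite Fm _. Qed.

Definition blocks (j : nat -> nat) (z : set nat) : set nat :=
  [set i | exists2 k, z k & (j k <= i < j k.+1)%N].

Section Blocks.
Variable j : nat -> nat.
Hypothesis jS : forall k, (j k < j k.+1)%N.

Lemma incr_le k l : (k <= l)%N -> (j k <= j l)%N.
Proof.
move=> kl; rewrite -(subnK kl); elim: (l - k)%N => // i IHi.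
by rewrite addSn; exact: leq_trans IHi (ltnW (jS _)).
Qed.

Lemma incr_ge k : (k <= j k)%N.
Proof. by elim: k => // k IHk; exact: leq_ltn_trans (jS k). Qed.

Lemma block_uniq k l i : (j k <= i < j k.+1)%N -> (j l <= i < j l.+1)%N -> k = l.
Proof.
move=> ki li; have [kl|lk|//] := ltngtP k l.
  by have := incr_le kl; lia.
by have := incr_le lk; lia.
Qed.

Lemma block_exists i : (j 0 <= i)%N -> exists k, (j k <= i < j k.+1)%N.
Proof.
move=> ji; have ex : exists k, (i < j k)%N by exists i.+1; exact: incr_ge.
case: (ex_minnP ex) => -[|k] ik kmin; first by lia.
by exists k; rewrite ik andbT leqNgt; apply/negP => /kmin; lia.
Qed.

(** Consecutive blocks alternate between x and its complement according to z. *)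
Lemma blocks_stretchy F z : moiety z ->
  (exists K, forall k, (K <= k)%N -> (F (j k) <= j k.+1)%N) ->
  stretchy F (blocks j z).
Proof.
move=> [/infinite_ge iz /infinite_ge iz'] [K Kj]; split=> n.
  have [k nk zk] := iz (maxn n K); exists (j k); first by have := incr_ge k; lia.
  by move=> i ?; exists k => //; have := Kj k; lia.
have [k nk zk] := iz' (maxn n K); exists (j k); first by have := incr_ge k; lia.
move=> i ik [l zl] /(block_uniq (k := k))kl; apply: zk; rewrite (kl _)//.
by have := Kj k; lia.
Qed.

Lemma blocksI z z' : blocks j z `&` blocks j z' `<=` blocks j (z `&` z').
Proof.
by move=> i [[k zk ki] [l zl li]]; exists k => //; split=> //; rewrite (block_uniq ki li).
Qed.

Lemma blocks_finite z : finite_set z -> finite_set (blocks j z).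
Proof.
move=> /finite_cnt[K zK]; apply: (sub_finite_set _ (finite_II (j K))) => i [k /zK].
by move=> /incr_le/=; lia.
Qed.
End Blocks.

Lemma evens_moiety : moiety [set n | ~~ odd n].
Proof.
split; apply/infinite_ge => k; first by exists k.*2; rewrite /= ?odd_double//; lia.
by exists k.*2.+1; rewrite /= ?odd_double//; lia.
Qed.

Section Sparse.
Local Open Scope ring_scope.
Variable R : realType.
Implicit Types (A B Q : set nat) (r : R).

Lemma natr_unbounded r : exists N : nat, forall n, (N <= n)%N -> r <= n%:R.
Proof.
exists (Num.truncn r).+1 => n rn.
by apply/ltW/(lt_le_trans (truncnS_gt _)); rewrite ler_nat.
Qed.

(** Let N be at least m^2 and let F m bound the preimages of the numbers below N.
    If x contains [m, F m[, then only m of the first N numbers can be missing from the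
    image of x. *)
Lemma stretchy_image_osc (p q : nat -> nat) (F : nat -> nat) x :
  cancel p q -> cancel q p ->
  (forall m, exists2 N, (m * m <= N)%N & forall i, (i < N)%N -> (q i < F m)%N) ->
  stretchy F x -> density R (p @` x) = osc R.
Proof.
move=> pq qp FN [Fx Fx'].
have H y : long_in F y -> forall (e : R) K, 0 < e ->
    exists2 n, (K <= n)%N & (1 - e) * n%:R <= (cnt (p @` y) n)%:R.
  move=> Fy e K e0; have [N Nn] := natr_unbounded e^-1.
  have [m Km my] := Fy (maxn (maxn N K) 1%N).
  have [n mn nF] := FN m; exists n; first by nia.
  have : (cnt (~` (p @` y)) n <= m)%N.
    apply: (cnt_le_image (g := p)) => i ni /= iy; exists (q i); last by rewrite qp.
    rewrite ltnNge; apply/negP => mqi; apply: iy; exists (q i); last by rewrite qp.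
    by apply: my; rewrite mqi nF.
  rewrite -(ler_nat R) natr_cntC.
  have em : 1 <= m%:R * e by rewrite -ler_pdivrMr// div1r; apply: Nn; lia.
  have : m%:R * m%:R <= n%:R :> R by rewrite -natrM ler_nat.
  have : 0 <= m%:R :> R by [].
  by nra.
apply: oscillates; first exact: H.
by move=> e K; rewrite -image_setC; [exact: H|exists q].
Qed.

Lemma stretchy_osc F x : (forall m, m * m <= F m)%N -> stretchy F x -> density R x = osc R.
Proof.
by move=> Fm; rewrite -[x in density R x](image_id x); apply: stretchy_image_osc => // m;
   exists (F m).
Qed.

Lemma has_density_perturb A B Q r : has_density Q (0 : R) ->
  A `<=` B `|` Q -> B `<=` A `|` Q -> has_density B r -> has_density A r.
Proof.
move=> Q0 AB BA Br e e0; have [|K Kn] := Q0 (e / 2); first by lra.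
have [|L Ln] := Br (e / 2); first by lra.
exists (maxn K L) => n; rewrite geq_max => /andP[/Kn + /Ln].
have := leq_trans (sub_cnt n AB) (cntU _ _ _).
have := leq_trans (sub_cnt n BA) (cntU _ _ _).
rewrite -!(ler_nat R) !natrD !ler_norml; lra.
Qed.

Lemma has_density0 : has_density set0 (0 : R).
Proof.
move=> e e0; exists 0%N => n _; have -> : cnt set0 n = 0%N.
  by apply/eqP; rewrite -leqn0 -(count_pred0 (iota 0 n)); apply: sub_count => i; rewrite in_set0.
by rewrite mul0r subrr normr0 mulr_ge0// ltW.
Qed.

Lemma has_density0_finite A : finite_set A -> has_density A (0 : R).
Proof.
move=> /finite_cnt[K AK]; apply: (has_density0_le (K := K) has_density0) => n.
by rewrite addnC; apply/(leq_trans _ (leq_addr _ _))/(cnt_le_image (g := id)) => i _ /AK;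
   exists i.
Qed.

Lemma has_density_infinite A r : has_density A r -> r != 0 -> infinite_set A.
Proof.
by move=> Ar /eqP r0 /has_density0_finite /(has_density_uniq Ar).
Qed.

Lemma has_density_moiety A r : has_density A r -> 0 < r < 1 -> moiety A.
Proof.
move=> Ar /andP[r0 r1]; split; first by apply: has_density_infinite Ar _; rewrite gt_eqF.
by apply: has_density_infinite (has_densityC Ar) _; rewrite subr_eq0 gt_eqF.
Qed.

Lemma sparse_moiety A : infinite_set A -> has_density A (0 : R) -> moiety A.
Proof.
move=> iA A0; split=> //; apply: has_density_infinite (has_densityC A0) _.
by rewrite subr0 oner_neq0.
Qed.

Lemma has_density_sub0 A B : A `<=` B -> has_density B (0 : R) -> has_density A (0 : R).
Proof. by move=> AB B0; apply: (has_density0_le (K := 0%N) B0) => n; rewrite addn0 sub_cnt. Qed.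

(** A set that is enumerated as fast as the squares has density zero: for each m,
    at most n/m + m squares lie below n. *)
Lemma has_density0_fast A (g : nat -> nat) :
  (exists n0, forall n, (n0 <= n)%N -> (n * n <= g n)%N) -> A `<=` range g ->
  has_density A (0 : R).
Proof.
move=> [n0 gn] Ag e e0; have [m m0 em] : exists2 m, (0 < m)%N & (e / 2)^-1 <= m%:R.
  by have [M Mn] := natr_unbounded (e / 2)^-1; exists M.+1 => //; exact: Mn.
have [L Ln] := natr_unbounded ((n0 + m)%:R / (e / 2)).
exists L => n /Ln; rewrite ler_pdivrMr; last by lra.
rewrite mul0r subr0 ger0_norm// natrD => nL.
have : (cnt A n * m <= n0 * m + n + m * m)%N.
  apply: leq_trans (_ : (n0 + n %/ m + m) * m <= _)%N; last first.
    by rewrite !mulnDl leq_add2r leq_add2l leq_trunc_div.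
  rewrite leq_mul2r; apply/orP; right; apply: (cnt_le_image (g := g)) => i ni.
  move=> /Ag[k _ ki]; exists k => //.
  have [kn0|n0k] := ltnP k n0; first by rewrite -addnA ltn_addr.
  have kn : (k * k < n)%N by apply: leq_ltn_trans ni; rewrite -ki gn.
  have [km|mk] := ltnP k m; first by rewrite addnC ltn_addr.
  have kd : (k <= n %/ m)%N by rewrite leq_divRL//; nia.
  by rewrite addnAC addnC (leq_ltn_trans kd)// -addn1 leq_add2l addn_gt0 m0 orbT.
rewrite -(ler_nat R) !natrD !natrM => H.
have mR : 0 < m%:R :> R by rewrite ltr0n.
have me : 1 <= m%:R * (e / 2).
  by rewrite -ler_pdivrMr ?div1r; [|lra].
rewrite -(ler_pM2r mR).
have : 0 <= n%:R :> R by [].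
by nra.
Qed.

Definition squares : set nat := range (fun k => (k * k)%N).

Lemma squares_sparse : has_density squares (0 : R).
Proof. by apply: (has_density0_fast (g := fun k => (k * k)%N)) => //; exists 0%N. Qed.

(** The set whose counting function is the integer part of r n has density r; even
    and odd squares are added and removed to make it infinite and coinfinite. *)
Lemma density_realized r : 0 <= r <= 1 -> exists2 A, moiety A & has_density A r.
Proof.
move=> /andP[r0 r1]; pose t n := Num.truncn (r * n%:R).
have rn n : 0 <= r * n%:R by rewrite mulr_ge0.
have tn n : (t n)%:R <= r * n%:R < (t n).+1%:R by rewrite truncn_itv.
have tS n : (t n <= t n.+1 <= (t n).+1)%N.
  have := tn n; have := tn n.+1; rewrite -!natr1 mulrDr mulr1 => /andP[a b] /andP[c d].
  have h1 : (t n)%:R < (t n.+1)%:R + 1 :> R by lra.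
  have h2 : (t n.+1)%:R < (t n)%:R + 2 :> R by lra.
  by move: h1 h2; rewrite natr1 -natrD !ltr_nat; lia.
pose D := [set n | t n != t n.+1].
have cD n : cnt D n = t n.
  elim: n => [|n IHn]; first by rewrite /t mulr0 truncn0.
  have -> : cnt D n.+1 = (cnt D n + (t n != t n.+1))%N.
    by rewrite cntS; congr (_ + nat_of_bool _)%N; apply/idP/idP; rewrite in_setE.
  by rewrite IHn; case: eqP => /=; have := tS n; lia.
pose Q0 := [set n | exists k, n = (k.*2 * k.*2)%N].
pose Q1 := [set n | exists k, n = (k.*2.+1 * k.*2.+1)%N].
exists ((D `|` Q0) `\` Q1).
  split; apply/infinite_ge => k.
    exists (k.*2 * k.*2)%N; first by nia.
    by split; [right; exists k|move=> [l]; nia].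
  by exists (k.*2.+1 * k.*2.+1)%N; [nia|move=> [_]; apply; exists k].
have Q0s : Q0 `<=` squares by move=> _ [k ->]; exists k.*2.
have Q1s : Q1 `<=` squares by move=> _ [k ->]; exists k.*2.+1.
apply: (has_density_perturb (B := D) squares_sparse).
- by move=> i [[Di|/Q0s Qi] _]; [left|right].
- move=> i Di; have [/Q1s|nQ] := pselect (Q1 i); first by right.
  by left; split=> //; left.
move=> e e0; have [N Nn] := natr_unbounded e^-1; exists N => n /Nn.
rewrite cD -div1r ler_pdivrMr// mulrC.
by have := tn n; rewrite -natr1 ler_norml; lra.
Qed.

Lemma osc_realized : exists2 A, moiety A & density R A = osc R.
Proof.
pose j := fix j k := if k is l.+1 then (j l * j l + j l).+1 else 0%N.
have jS k : (j k < j k.+1)%N by rewrite /= ltnS leq_addl.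
have st : stretchy (fun m => (m * m + m).+1) (blocks j [set n | ~~ odd n]).
  by apply: blocks_stretchy evens_moiety _ => //; exists 0%N.
exists (blocks j [set n | ~~ odd n]); first by apply: stretchy_moiety st => m; lia.
by apply: stretchy_osc st => m; lia.
Qed.

End Sparse.

(** * Category in the Cantor space *)

Lemma cylinderP (x y : cantor_space) n :
  cylinder (mkseq y n) x <-> forall i, i < n -> x i = y i.
Proof.
split=> [xn i lin|xn i]; last by rewrite size_mkseq => lin; rewrite nth_mkseq// xn.
by rewrite (xn i) ?size_mkseq// nth_mkseq.
Qed.

Lemma nbhs_cylinder (y : cantor_space) n : nbhs y (cylinder (mkseq y n)).
Proof.
suff H i : nbhs y [set x : cantor_space | x i = y i].
  elim: n => [|n IHn]; first by apply: filterS filterT => x _; exact/cylinderP.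
  apply: filterS (filterI IHn (H n)) => x [/cylinderP xn /= xyn].
  apply/cylinderP => i; rewrite ltnS leq_eqVlt => /predU1P[->//|]; exact: xn.
have := @proj_continuous _ (fun _ : nat => bool) i y [set y i].
by apply; exact: discrete_set1.
Qed.

Lemma nbhs_cantorP (y : cantor_space) U :
  nbhs y U -> exists n, cylinder (mkseq y n) `<=` U.
Proof.
pose F := filter_from [set: nat] (fun n => cylinder (mkseq y n)).
suff /[apply] -[n _ nU] : F --> y by exists n.
have FF : Filter F.
  apply: filter_from_filter; first by exists 0.
  move=> i j _ _; exists (maxn i j) => // x /cylinderP xij.
  by split; apply/cylinderP => k ?; apply: xij; lia.
apply/cvg_sup => i A /= [_ [[B Bop <-] /= By BA]].
exists i.+1 => // x /cylinderP xi; apply: BA => /=.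
by rewrite /= xi.
Qed.

Definition matches (w : seq bool) n (y : nat -> bool) :=
  forall i, i < size w -> y (n + i) = nth false w i.

Definition eventually_avoids (W : nat -> seq bool) : set cantor_space :=
  [set y | exists N, forall n, N <= n -> ~ matches (W n) n y].

Lemma matches_cat w w' n y : matches (w ++ w') n y <->
  matches w n y /\ matches w' (n + size w) y.
Proof.
split=> [ww'|[mw mw'] i].
  split=> i isz; first by rewrite ww' ?nth_cat ?isz// size_cat ltn_addr.
  by rewrite -addnA ww' ?nth_cat ?size_cat ?ltn_add2l// ltnNge leq_addr /= addKn.
rewrite size_cat nth_cat => iw'; have [wi|wi] := ltnP i (size w); first exact: mw.
by rewrite -[in LHS](subnKC wi) addnA mw'//; lia.
Qed.

(** Some point of the cylinder of t lies outside the closure of A, hence has a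
    neighbourhood missing A, and every neighbourhood contains a cylinder. *)
Lemma nowhere_dense_extension (A : set cantor_space) (t : seq bool) : nowhere_dense A ->
  exists w, forall y, matches t 0 y -> matches w (size t) y -> ~ A y.
Proof.
move=> nA; have [y ty nAy] : exists2 y : cantor_space, matches t 0 y & ~ closure A y.
  apply: contrapT => H; have : interior (closure A) (nth false t).
    have := @nbhs_cylinder (nth false t) (size t); apply: filterS => x /cylinderP xt.
    by apply: contrapT => nAx; apply: H; exists x => // i /xt.
  by rewrite nA.
have {nAy}[U [/nbhs_cantorP[n nU] AU]] : exists U, nbhs y U /\ ~ (A `&` U !=set0).
  have /existsNP[U /not_implyP[yU AU]] := nAy.
  by exists U.
exists (mkseq (fun i => y (size t + i)) n) => z tz wz Az; apply: AU; exists z; split=> //.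
apply: nU; apply/cylinderP => i lin; have [it|ti] := ltnP i (size t).
  by rewrite -[i]add0n tz// ty.
by rewrite -(subnKC ti) wz ?size_mkseq ?nth_mkseq//; lia.
Qed.

(** The extensions are concatenated, over the strings and over the sets. *)
Lemma nowhere_dense_common_extension (F : nat -> set cantor_space) (k : nat)
  (ts : seq (seq bool)) (n : nat) : (forall j, nowhere_dense (F j)) ->
  (forall t, t \in ts -> size t = n) ->
  exists w, forall t j y, t \in ts -> j < k -> matches t 0 y -> matches w n y -> ~ F j y.
Proof.
move=> nF; elim: ts => [|t ts IHts] tsn; first by exists [::].
have [|w wP] := IHts; first by move=> u uts; apply: tsn; rewrite inE uts orbT.
have tn : size t = n by apply: tsn; exact: mem_head.
have [w' w'P] : exists w', forall j y, j < k -> matches t 0 y -> matches (w ++ w') n y ->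
    ~ F j y.
  elim: k {IHts wP} => [|k [w' w'P]]; first by exists [::].
  have sz : size (mkseq (nth false (t ++ w ++ w')) (n + size (w ++ w'))) = n + size (w ++ w').
    by rewrite size_mkseq.
  have [v vP] := nowhere_dense_extension (t ++ w ++ w') (nF k).
  exists (w' ++ v) => j y; rewrite ltnS leq_eqVlt catA => /predU1P[->|jk] ty.
    move=> /matches_cat[ww' vy]; apply: vP; first by apply/matches_cat; rewrite tn.
    by rewrite size_cat tn.
  by move=> /matches_cat[ww' _]; exact: w'P ww'.
exists (w ++ w') => u j y; rewrite inE => /predU1P[->|uts] jk uy wy; first exact: w'P wy.
by apply: (wP u) => //; move: wy => /matches_cat[].
Qed.

(** To each position n belongs a word that, appended to any string of length n, avoids
    the nowhere dense sets up to the n-th; a sequence in which infinitely many of these words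
    occur at their positions avoids the union. Conversely, to avoid all the words from
    some position on is a nowhere dense condition. *)
Lemma meagerP (A : set cantor_space) :
  meager A <-> exists W, A `<=` eventually_avoids W.
Proof.
split=> [[F [nF ->]]|[W AW]].
  have /choice[W WP] n : exists w, forall j y, j <= n -> matches w n y -> ~ F j y.
    have [t /mapP[u _ ->]|w wP] := @nowhere_dense_common_extension F n.+1
        (map (@tval n bool) (enum {: n.-tuple bool})) n nF.
      by rewrite size_tuple.
    exists w => j y jn wy; apply: (wP (mkseq y n)) => //.
      have sy : size (mkseq y n) == n by rewrite size_mkseq.
      by apply/mapP; exists (Tuple sy); rewrite ?mem_enum.
    by move=> i; rewrite size_mkseq => lin; rewrite nth_mkseq.
  exists W => y [j _ Fjy]; exists j => n jn wy.
  exact: (WP n j y jn wy).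
exists (fun N => A `&` [set y | forall n, N <= n -> ~ matches (W n) n y]); split; last first.
  apply/seteqP; split=> [y Ay|y [N _ []//]].
  by have [N Ny] := AW _ Ay; exists N.
move=> N; apply/seteqP; split=> // y /nbhs_cantorP[n nA].
pose m := maxn n N.
pose z i := if i < m then y i else nth false (W m) (i - m).
have /nA zA : cylinder (mkseq y n) z.
  by apply/cylinderP => i lin; rewrite /z; case: ltnP => //; lia.
have [x [[Ax xW] /cylinderP xz]] := zA _ (nbhs_cylinder z (m + size (W m))).
apply: (xW m) => [|i iW]; first by lia.
by rewrite xz ?ltn_add2l// /z ltnNge leq_addr /= addKn.
Qed.

Lemma meagerS A B : A `<=` B -> meager B -> meager A.
Proof. by move=> AB /meagerP[W BW]; apply/meagerP; exists W; exact: subset_trans BW. Qed.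

Lemma meagerU A B : meager A -> meager B -> meager (A `|` B).
Proof.
move=> /meagerP[V AV] /meagerP[W BW]; apply/meagerP.
exists (fun n => V n ++ W (n + size (V n))) => y [/AV|/BW] [N Ny]; exists N => n Nn.
  by move=> /matches_cat[+ _]; exact: Ny.
by move=> /matches_cat[_]; apply: Ny; lia.
Qed.

(** The word at position n differs from each of the first n sequences. *)
Lemma countable_meager A : countable A -> meager A.
Proof.
move=> /countable_injP[e eI]; apply/meagerP.
pose y k := xget (fun=> false) [set y : cantor_space | A y /\ e y = k].
exists (fun n => mkseq (fun i => ~~ y i (n + i)) n.+1) => x Ax; exists (e x) => n xn /(_ (e x)).
rewrite size_mkseq nth_mkseq ?ltnS// => /(_ xn).
suff -> : y (e x) = x by case: (x _).
have [|Ay ey] := xgetPex (fun=> false) (P := [set y : cantor_space | A y /\ e y = e x]).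
  by exists x.
by apply: eI; rewrite ?inE.
Qed.

(** Words placed one after the other, each at the position where the previous
    one ends: the diagonal argument behind the Baire category theorem. *)
Lemma not_meager_setT : ~ meager [set: cantor_space].
Proof.
move=> /meagerP[W]; pose j := fix j k := if k is l.+1 then (j l + size (W (j l))).+1 else 0.
have jS k : j k < j k.+1 by rewrite /= ltnS leq_addr.
pose k i := xget 0 [set k | j k <= i < j k.+1].
pose y i := nth false (W (j (k i))) (i - j (k i)).
move=> /(_ y I)[N Ny]; apply: (Ny (j N)) => [|i iW]; first exact: incr_ge.
have ki : j N <= j N + i < j N.+1 by rewrite leq_addr /= ltnS leq_add2l ltnW.
suff kE : k (j N + i) = N by rewrite /y kE addKn.
have := xgetPex 0 (P := [set k | j k <= j N + i < j k.+1]) (ex_intro _ N ki).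
by move=> h; exact: (block_uniq jS h ki).
Qed.

(** * Density numbers, and the upper bound non(M) *)

Lemma least_size_le T (P : set (set T)) F c :
  P F -> (Defs.card F <= c)%O -> (least_size P <= c)%O.
Proof.
move=> PF; apply: le_trans; have [|_ lb] := @leastP [set Defs.card F | F in P].
  by exists (Defs.card F), F.
by apply: lb; exists F.
Qed.

Lemma least_size_ge T (P : set (set T)) c : P !=set0 ->
  (forall F, P F -> (c <= Defs.card F)%O) -> (c <= least_size P)%O.
Proof.
move=> [F PF] Pc; have [|[G PG GE] _] := @leastP [set Defs.card F | F in P].
  by exists (Defs.card F), F.
by rewrite /least_size -GE; exact: Pc.
Qed.

Lemma least_size_attained T (P : set (set T)) : P !=set0 ->
  exists2 F, P F & Defs.card F = least_size P.
Proof.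
move=> [F PF]; have [|[G PG GE] _] := @leastP [set Defs.card F | F in P]; last by exists G.
by exists (Defs.card F), F.
Qed.

Lemma card_image_leq T U (f : T -> U) (A : set T) :
  (Defs.card (f @` A) <= Defs.card A)%O.
Proof. by rewrite cardinal_leE; exact: card_image_le. Qed.

Section Witnesses.
Variable R : realType.
Implicit Types (X Y : set (option R)) (P : set (nat -> nat)).

(** The families over which [dd] minimizes. *)
Definition witness X Y : set (set (nat -> nat)) :=
  [set P | P `<=` Defs.Sym /\ forall A : set nat, infinite_set A ->
    infinite_set (~` A) -> X (density R A) ->
    exists2 p, P p & Y (density R (p @` A)) /\ density R (p @` A) <> density R A].

Lemma every_density_realized d : all_densities R d ->
  exists2 A, moiety A & density R A = d.
Proof.
case=> [[r + <-]|->]; last exact: osc_realized.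
by rewrite /= in_itv => /density_realized[A mA /densityP]; exists A.
Qed.

(** Any infinite coinfinite set can be mapped to one of the desired density. *)
Lemma Sym_witness X Y : dd_defined X Y -> witness X Y Defs.Sym.
Proof.
move=> [_ Yall _ XY]; split=> // A iA iA' /XY[y Yy yA].
have [B mB By] := every_density_realized (Yall _ Yy).
exists (shuffle A B); first exact: shuffle_bij.
by rewrite shuffle_image// By.
Qed.

Lemma dd_le X Y P c : witness X Y P -> (Defs.card P <= c)%O -> (dd X Y <= c)%O.
Proof. exact: least_size_le. Qed.

Lemma dd_ge X Y c : dd_defined X Y ->
  (forall P, witness X Y P -> (c <= Defs.card P)%O) -> (c <= dd X Y)%O.
Proof. by move=> dXY; apply: least_size_ge; exists Defs.Sym; exact: Sym_witness. Qed.

Lemma dd_attained X Y : dd_defined X Y ->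
  exists2 P, witness X Y P & Defs.card P = dd X Y.
Proof. by move=> dXY; apply: least_size_attained; exists Defs.Sym; exact: Sym_witness. Qed.

Lemma dd_mono X Y X' Y' : X `<=` X' -> dd_defined X' Y' ->
  (forall x y, X x -> Y' y -> y <> x -> Y y) -> (dd X Y <= dd X' Y')%O.
Proof.
move=> XX' d' YY'; apply: dd_ge => // P [Psym PP]; apply: (@dd_le _ _ P) => //.
split=> // A iA iA' XA; have [p Pp [Yp npA]] := PP A iA iA' (XX' _ XA).
by exists p => //; split=> //; exact: YY' XA Yp npA.
Qed.

Lemma dd_subset X Y X' Y' : X `<=` X' -> Y' `<=` Y -> dd_defined X' Y' ->
  (dd X Y <= dd X' Y')%O.
Proof. by move=> XX' YY' d; apply: dd_mono => // *; exact: YY'. Qed.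

Lemma Icc01_all : Icc01 R `<=` all_densities R. Proof. by left. Qed.

Lemma Ioo01_Icc01 : Ioo01 R `<=` Icc01 R.
Proof.
move=> _ [r + <-]; rewrite /= in_itv /= => /andP[r0 r1]; exists r => //.
by rewrite /= in_itv /= !ltW.
Qed.

Lemma ends01_Icc01 : ends01 R `<=` Icc01 R.
Proof.
by move=> _ [->|->]; [exists 0%R|exists 1%R]; rewrite //= in_itv /= lexx ler01.
Qed.

Lemma Icc01_osc : ~ Icc01 R (osc R). Proof. by case. Qed.

Lemma in_Ioo01 r : Ioo01 R (Some r) <-> (0 < r < 1)%R.
Proof.
split=> [[s + [<-]]|r01]; first by rewrite /= in_itv.
by exists r => //; rewrite /= in_itv.
Qed.

Lemma half_Ioo01 : Ioo01 R (Some (2^-1)%R).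
Proof. by apply/in_Ioo01; lra. Qed.

End Witnesses.
#[global] Hint Resolve Icc01_all Ioo01_Icc01 ends01_Icc01 Icc01_osc : core.

(** Agreement with A on long intervals is what a generic x satisfies; for the full
    and the empty set A it amounts to being stretchy. *)
Definition agrees F (A x : set nat) :=
  forall K, exists2 m, K <= m & forall i, m <= i < F m -> (x i <-> A i).

Lemma agrees_stretchy F x : agrees F setT x -> agrees F set0 x -> stretchy F x.
Proof.
move=> T0 T1; split=> K; first by have [m Km mF] := T0 K; exists m => // i /mF[_]; exact.
by have [m Km mF] := T1 K; exists m => // i /mF[h _] /h.
Qed.

Definition trues (y : cantor_space) : set nat := [set i | y i].

(** The word for position n is the indicator function of A on [n, F n[. *)
Lemma agrees_comeager F (A : set nat) : meager [set y | ~ agrees F A (trues y)].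
Proof.
apply/meagerP; exists (fun n => mkseq (fun i => (n + i) \in A) (F n - n)) => y /existsNP[K yK].
exists K => n Kn yn; apply: yK; exists n => // i ni.
have := yn (i - n); rewrite size_mkseq nth_mkseq ?subnKC; [|lia|lia].
rewrite /trues /= => ->; last by lia.
by rewrite in_setE.
Qed.

Lemma stretchy_comeager F : meager [set y | ~ stretchy F (trues y)].
Proof.
apply: meagerS (meagerU (agrees_comeager F setT) (agrees_comeager F set0)) => y /= ny.
by apply/not_andP => -[y1 y0]; apply: ny; exact: agrees_stretchy y1 y0.
Qed.

Section Generic.
Variable R : realType.
Local Open Scope ring_scope.

Lemma squares_moiety : moiety squares.
Proof.
apply: (@sparse_moiety R); last exact: squares_sparse.
by apply/infinite_ge => k; exists (k * k)%N; [nia|exists k].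
Qed.

(** Where x agrees with A on a long interval, almost all of the elements of x
    seen so far are in A, and x fills almost everything. *)
Lemma agrees_shuffle (A x : set nat) F : infinite_set A ->
  (forall m, (m * m + m <= cnt A (F m))%N) -> moiety x -> agrees F A x ->
  forall (e : R) K, 0 < e -> exists2 n, (K <= n)%N &
    (1 - e) * n%:R <= (cnt (shuffle x (~` squares) @` A) n)%:R.
Proof.
move=> iA FA mx xA e K e0; pose C := ~` squares.
have mC : moiety C := moietyC squares_moiety.
have [|L Ln] := @squares_sparse R (e / 2); first by lra.
have [M Mn] := natr_unbounded (e / 2)^-1.
have [m mK mF] := xA (maxn (maxn K L) (maxn M 1)).
pose a := cnt (A `&` x) (F m); pose k := cnt x (F m).
have [Cn Ck] := eltP k mC.1; set n := elt C k in Cn Ck.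
have am : (m * m <= a)%N.
  have : (cnt A (F m) <= a + m)%N by apply: cnt_near => i /mF xAi Ai; split=> //; exact/xAi.
  by have := FA m; lia.
have ka : (k <= a + m)%N by apply: cnt_near => i /mF xAi xi; split=> //; exact/xAi.
have ak : (a <= k)%N by apply: sub_cnt => i [].
have nk : (n = k + cnt squares n)%N by rewrite -[LHS](cntC C) Ck setCK.
have nK : (maxn K L <= n)%N by nia.
exists n; first by lia.
apply: (@le_trans _ _ a%:R); last first.
  rewrite ler_nat /a -(@cnt_shuffleI A x C n (F m)) ?Ck//.
  by apply: sub_cnt => i [j [Aj _] <-]; exists j.
have /Ln : (L <= n)%N by lia.
rewrite mul0r subr0 ger0_norm// => sn.
have : n%:R <= a%:R + m%:R + (cnt squares n)%:R :> R by rewrite -!natrD ler_nat {1}nk; lia.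
have em : 1 <= m%:R * (e / 2).
  by rewrite -ler_pdivrMr ?div1r; [apply: Mn; lia|lra].
have : m%:R * m%:R <= n%:R :> R by rewrite -natrM ler_nat; lia.
have : 0 <= m%:R :> R by [].
by nra.
Qed.

(** A nonmeager set contains a sequence that is generic for A: the shuffle along it
    makes A oscillate. *)
Lemma dd_le_non_meager (Y : set (option R)) : Y (osc R) -> (dd (Icc01 R) Y <= non meager)%O.
Proof.
move=> Yosc; apply: least_size_ge; first by exists setT; exact: not_meager_setT.
move=> S nS; pose P := [set shuffle (trues y) (~` squares) | y in
  [set y : nat -> bool | S y /\ moiety (trues y)]].
apply: (@dd_le _ _ _ P); last first.
  rewrite -[X in (_ <= X)%O]/(@Defs.card (nat -> bool) S) cardinal_leE.
  apply: card_le_trans (card_image_le _ _) _.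
  by apply: subset_card_le => y [].
have mC : moiety (~` squares) := moietyC squares_moiety.
split=> [_ [y [_ my] <-]|A iA iA' dA]; first exact: shuffle_bij.
have /choice[F FA] (m : nat) := infinite_cnt (m * m + m) iA.
have /choice[G GA] (m : nat) := infinite_cnt (m * m + m) iA'.
have [y [Sy [yF [yG ySt]]]] : exists y, S y /\ (agrees F A (trues y) /\
    (agrees G (~` A) (trues y) /\ stretchy succn (trues y))).
  apply: contrapT => H; apply: nS.
  apply: meagerS (meagerU (agrees_comeager F A) (meagerU (agrees_comeager G (~` A))
    (stretchy_comeager succn))) => y Sy.
  apply: contrapT => /not_orP[/contrapT yF /not_orP[/contrapT yG /contrapT yS]].
  by apply: H; exists y.
have my : moiety (trues y) by apply: stretchy_moiety ySt => m.
exists (shuffle (trues y) (~` squares)); first by exists y.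
have -> : density R (shuffle (trues y) (~` squares) @` A) = osc R.
  apply: oscillates; first exact: agrees_shuffle.
  move=> e K; rewrite -image_setC; last exact: shuffle_bij.
  exact: agrees_shuffle.
by split=> // oscA; apply: (@Icc01_osc R); rewrite oscA.
Qed.
End Generic.

(** * The lower bounds cov(M) and b *)

Section NonStretchy.
Variables (P : set (nat -> nat)) (F : (nat -> nat) -> nat -> nat).
Hypothesis PF : forall x, exists2 p, P p & ~ stretchy (F p) x.

(** Being stretchy is generic, and no x is stretchy for all p in P. *)
Lemma cov_meager_le : (cov meager <= Defs.card P)%O.
Proof.
pose M p (y : nat -> bool) : Prop := ~ stretchy (F p) (trues y).
apply: (least_size_le (F := M @` P)); last first.
  rewrite -[X in (X <= _)%O]/(@Defs.card ((nat -> bool) -> Prop) (M @` P)).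
  exact: card_image_leq.
split=> [_ [p _ <-]|]; first exact: stretchy_comeager.
apply/seteqP; split=> // y _; have [p Pp np] := PF (trues y).
by exists (M p) => //; exists p.
Qed.

(** A bound of all the functions F p would give an interval partition whose
    alternate blocks form a set that is stretchy for all of them. *)
Lemma unbounding_number_le : (unbounding_number <= Defs.card P)%O.
Proof.
apply: (least_size_le (F := F @` P)); last exact: card_image_leq.
move=> [g gF]; pose j := fix j k := if k is l.+1 then maxn (g (j l)) (j l).+1 else 0.
have jS k : j k < j k.+1 by rewrite /= leq_max ltnSn orbT.
have [p Pp] := PF (blocks j [set n | ~~ odd n]); apply.
apply: (blocks_stretchy jS evens_moiety).
have [|K _ Kn] := gF (F p); first by exists p.
exists K => k Kk; apply: leq_trans (Kn (j k) _) _; last by rewrite /= leq_max leqnn.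
by apply: leq_trans Kk _; exact: (incr_ge jS).
Qed.
End NonStretchy.

Lemma bounded_preimage (q : nat -> nat) N : exists M, forall i, i < N -> q i < M.
Proof.
exists (\max_(i < N) q i).+1 => i iN.
by rewrite ltnS (leq_bigmax (Ordinal iN)).
Qed.

Section LowerBounds.
Variable R : realType.
Local Open Scope ring_scope.

Lemma dd_defined_osc_all : dd_defined [set osc R] (all_densities R).
Proof.
split=> [_ ->|//||_ ->]; [by right|by exists (osc R)|].
by exists (Some 0) => //; apply: Icc01_all; exists 0 => //; rewrite /= in_itv /= lexx ler01.
Qed.

(** A set x that is stretchy for all p in P oscillates, and so do all its images
    under P. *)
Lemma osc_witness_nonstretchy P : witness [set osc R] (all_densities R) P ->
  exists F, forall x, exists2 p, P p & ~ stretchy (F p) x.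
Proof.
move=> [Psym PP].
have /choice[F FP] p : exists F, forall q, cancel p q -> cancel q p ->
    forall m, (m * m + m < F m)%N /\ forall i, (i < m * m)%N -> (q i < F m)%N.
  have [[q qp pq]|np] := pselect (exists2 q, cancel q p & cancel p q); last first.
    by exists id => q pq qp; case: np; exists q.
  have /choice[M MP] (m : nat) := bounded_preimage q (m * m).
  exists (fun m => (M m + m * m + m).+1) => q' pq' qp' m; split; first by lia.
  move=> i im; have -> : q' i = q i by apply: (can_inj pq); rewrite qp' qp.
  by have := MP m i im; lia.
exists F => x; apply: contrapT => H.
have stx p : P p -> stretchy (F p) x.
  by move=> Pp; apply: contrapT => nst; apply: H; exists p.
have [A [iA iA'] Ao] := osc_realized R.
have [p0 Pp0 _] := PP A iA iA' Ao.
have [q0 pq0 qp0] := Psym _ Pp0; have FP0 := FP p0 q0 pq0 qp0.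
have mx : moiety x.
  by apply: stretchy_moiety (stx _ Pp0) => m; have [h _] := FP0 m; lia.
have xo : density R x = osc R.
  by apply: stretchy_osc (stx _ Pp0) => m; have [h _] := FP0 m; lia.
have [p Pp [_]] := PP x mx.1 mx.2 xo; rewrite xo; apply.
have [q pq qp] := Psym _ Pp; apply: (@stretchy_image_osc R p q (F p) x pq qp _ (stx _ Pp)) => m.
by exists (m * m)%N => //; have [] := FP p q pq qp m.
Qed.

(** One element of each pair {2n, 2n + 1}, the odd one when n is in x. *)
Definition transversal (x : set nat) : set nat := [set i | odd i <-> x i./2].

Lemma cnt_transversal x n : (n <= 2 * cnt (transversal x) n + 1 <= n + 2)%N.
Proof.
have H m : cnt (transversal x) m.*2 = m.
  elim: m => // m IHm; rewrite doubleS !cntS IHm -addnA.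
  suff -> : ((m.*2 \in transversal x) + (m.*2.+1 \in transversal x) = 1)%N by rewrite addn1.
  have t0 : transversal x m.*2 <-> ~ x m.
    rewrite /transversal /= odd_double doubleK.
    by split=> [[_ h] /h//|nx]; split=> // /nx.
  have t1 : transversal x m.*2.+1 <-> x m.
    by rewrite /transversal /= odd_double uphalf_double; split=> [[h _]|xm //]; exact: h.
  have [xm|xm] := pselect (x m); first by rewrite memNset ?mem_set//; [exact/t1|move/t0].
  by rewrite mem_set ?memNset//; [move/t1|exact/t0].
rewrite -(odd_double_half n); move: (odd n) (n./2) => b k.
case: b; rewrite ?add1n ?add0n ?cntS H; last by lia.
by case: (_ \in transversal x) => /=; lia.
Qed.

Lemma has_density_transversal x : has_density (transversal x) (2^-1 : R).
Proof.
move=> e e0; have [N Nn] := natr_unbounded e^-1; exists N => n /Nn en.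
have {}en : 1 <= n%:R * e by rewrite -ler_pdivrMr// div1r.
have /andP[] := cnt_transversal x n; rewrite -!(ler_nat R) !(natrM, natrD) ler_norml.
by lra.
Qed.

Lemma has_density_sample A (l z : R) : has_density A z ->
  (forall e K, 0 < e -> exists2 n, (K <= n)%N &
    `|(cnt A n)%:R - l * n%:R| <= e * n%:R) -> z = l.
Proof.
move=> Az Al; apply/eqP; rewrite -subr_eq0 -normr_eq0; apply/negPn/negP => n0.
have d0 : 0 < `|z - l| by rewrite lt_neqAle eq_sym n0 normr_ge0.
have [|K Kn] := Az (`|z - l| / 3); first by lra.
have [|n Kn' ln] := Al (`|z - l| / 3) K.+1; first by lra.
have := Kn n (ltnW Kn'); move: ln; set d := `|z - l|.
have nR : 0 < n%:R :> R by rewrite ltr0n; lia.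
move=> h1 h2; have := ler_distD (cnt A n)%:R (z * n%:R) (l * n%:R).
rewrite -mulrBl normrM (ger0_norm (ltW nR)) -/d [X in _ <= X + _]distrC => h3.
have : 0 < d := d0; nra.
Qed.

(** Along the stretches of x, the image of a transversal looks like the image
    of the evens, or like the image of the odds. *)
Lemma transversal_image (p q : nat -> nat) (F : nat -> nat) (l : R) (x : set nat) :
  cancel p q -> cancel q p ->
  (forall m, exists N, [/\ (m * m <= N)%N,
    `|(cnt (p @` [set n | ~~ odd n]) N)%:R - l * N%:R| * m%:R <= N%:R &
    forall i, (i < N)%N -> (q i < (F m).*2)%N]) ->
  stretchy F x ->
  forall z : R, has_density (p @` transversal x) z -> z = 2^-1.
Proof.
move=> pq qp FN [xF xF'] z Az; pose E : set nat := [set n | ~~ odd n].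
have bp : bijective p by exists q.
have H (y B : set nat) (l' : R) : long_in F y ->
    (forall i, y i./2 -> (transversal x i <-> B i)) ->
    (forall n, `|(cnt (p @` B) n)%:R - l' * n%:R| = `|(cnt (p @` E) n)%:R - l * n%:R|) ->
    z = l'.
  move=> yF yB BE; apply: (has_density_sample Az) => e K e0.
  have [M Mn] := natr_unbounded (e / 3)^-1.
  have [m mK my] := yF (maxn (maxn K M) 1).
  have [N [mN lN qN]] := FN m; exists N; first by nia.
  have near C C' : (forall i, y i./2 -> C i -> C' i) ->
      (cnt (p @` C) N <= cnt (p @` C') N + m.*2)%N.
    move=> CC; apply: leq_trans (_ : cnt (p @` C' `|` p @` `I_m.*2) N <= _)%N; last first.
      apply: leq_trans (cntU _ _ _) _; rewrite leq_add2l.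
      by apply: (cnt_le_image (g := p)) => i _ [k /= km <-]; exists k.
    apply: leq_trans (_ : cnt (p @` C) N <= _)%N => //.
    rewrite -[leqRHS]addn0; apply: cnt_near => i iN [k Ck ki].
    have [km|mk] := ltnP k m.*2; first by right; exists k.
    left; exists k => //; apply: CC Ck; apply: my.
    have := qN i; rewrite -ki pq; lia.
  have nB := near _ _ (fun i yi => (yB i yi).1).
  have nB' := near _ _ (fun i yi => (yB i yi).2).
  have em : 1 <= m%:R * (e / 3) by rewrite -ler_pdivrMr ?div1r; [apply: Mn; lia|lra].
  have mm : m%:R * m%:R <= N%:R :> R by rewrite -natrM ler_nat.
  have m0 : 0 <= m%:R :> R by [].
  move: lN; rewrite -BE => lN.
  have {}lN : `|(cnt (p @` B) N)%:R - l' * N%:R| <= (e / 3) * N%:R.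
    have : 0 <= `|(cnt (p @` B) N)%:R - l' * N%:R| by [].
    by nra.
  have mN' : m.*2%:R <= 2 * (e / 3) * N%:R :> R by rewrite -muln2 natrM; nra.
  move: nB nB' lN; rewrite -!(ler_nat R) !natrD !ler_norml; lra.
have zl : z = l.
  apply: (H (~` x) E) => // i /= nxi; rewrite /E /transversal /=.
  by split=> [[oi _]|/negP noi]; [apply/negP => /oi|].
have zl' : z = 1 - l.
  apply: (H x (~` E)) => // [i xi|n].
    by rewrite /E /transversal /=; split=> [[_ /(_ xi) ->]//|/negP/negPn oi]; split.
  rewrite image_setC// natr_cntC -normrN; congr `|_|; lra.
lra.
Qed.

Lemma dd_defined_Ioo01_Icc01 : dd_defined (Ioo01 R) (Icc01 R).
Proof.
split=> //; first by move=> d /Ioo01_Icc01 /Icc01_all.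
  by exists (Some 2^-1); exact: half_Ioo01.
move=> _ [r + <-]; rewrite /= in_itv /= => /andP[r0 r1].
by exists (Some 0); [apply: ends01_Icc01; left|move=> [r00]; move: r0; rewrite -r00 ltxx].
Qed.

(** The image of the transversal can only have density 1/2, which is the density of
    the transversal itself, or none. *)
Lemma Ioo01_witness_nonstretchy P : witness (Ioo01 R) (Icc01 R) P ->
  exists F, forall x, exists2 p, P p & ~ stretchy (F p) x.
Proof.
move=> [Psym PP].
have /choice[F FP] p : exists F, forall q, cancel p q -> cancel q p ->
    exists l : R, forall m, exists N, [/\ (m * m <= N)%N,
      `|(cnt (p @` [set n | ~~ odd n]) N)%:R - l * N%:R| * m%:R <= N%:R &
      forall i, (i < N)%N -> (q i < (F m).*2)%N].
  have [[q qp pq]|np] := pselect (exists2 q, cancel q p & cancel p q); last first.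
    by exists id => q pq qp; case: np; exists q.
  have [l lP] := cluster_point (@frequency_bounds R (p @` [set n | ~~ odd n])).
  have /choice[N NP] (m : nat) : exists N : nat, (m * m <= N)%N /\
      `|(cnt (p @` [set n | ~~ odd n]) N)%:R - l * N%:R| * m%:R <= N%:R.
    have [|n nm ln] := lP m.+1%:R^-1 (m * m).+1; first by rewrite invr_gt0.
    exists n; split; first exact: ltnW.
    have n0 : 0 < n%:R :> R by rewrite ltr0n; lia.
    move: ln; rewrite frequencyE -(ler_pM2r n0) -{2}[n%:R]gtr0_norm// -normrM mulrBl.
    rewrite divfK ?gt_eqF// [X in _ <= X]mulrC ler_pdivlMr ?ltr0n// => h; apply: le_trans h.
    by rewrite ler_wpM2l// ler_nat.
  have /choice[M MP] (m : nat) := bounded_preimage q (N m).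
  exists M => q' pq' qp'; exists l => m; exists (N m); have [h1 h2] := NP m; split=> // i iN.
  have -> : q' i = q i by apply: (can_inj pq); rewrite qp' qp.
  by have := MP m i iN; lia.
exists F => x; apply: contrapT => H.
have dT := has_density_transversal x.
have [iT iT'] : moiety (transversal x) by apply: has_density_moiety dT _; lra.
have TE : density R (transversal x) = Some 2^-1 by apply/densityP.
have [|p Pp [[r _ pr] np]] := PP _ iT iT'; first by rewrite TE; exact: half_Ioo01.
have [q pq qp] := Psym _ Pp; have [l lP] := FP p q pq qp.
have stx : stretchy (F p) x by apply: contrapT => nst; apply: H; exists p.
apply: np; rewrite TE -pr; congr Some.
by apply: (transversal_image pq qp lP stx); apply/densityP.
Qed.
End LowerBounds.

(** * The upper bound r *)

Section Reaping.
Variable R : realType.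
Local Open Scope ring_scope.

(** The k^2-th elements of B, for all k, form a set that is at least as sparse as
    the squares. *)
Lemma sparse_infinite_subset (B : set nat) : infinite_set B ->
  exists B', [/\ B' `<=` B, infinite_set B' & has_density B' (0 : R)].
Proof.
move=> iB; pose g k := elt B (k * k); have gk k : (k * k <= g k)%N by exact: elt_ge.
exists (range g); split=> [_ [k _ <-]||]; first by have [] := eltP (k * k) iB.
  by apply/infinite_ge => k; exists (g k); [have := gk k; nia|exists k].
by apply: (has_density0_fast (g := g)); [exists 0%N|exact: subset_refl].
Qed.

(** Shrinking its members to density zero keeps a reaping family reaping. *)
Lemma reaping_sparse : exists s : set nat -> set nat, forall B,
  infinite_set B -> [/\ s B `<=` B, moiety (s B) & has_density (s B) (0 : R)].
Proof.
suff /choice[s sP] : forall B, exists B', infinite_set B ->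
  [/\ B' `<=` B, moiety B' & has_density B' (0 : R)] by exists s.
move=> B; have [iB|nB] := pselect (infinite_set B); last by exists B.
have [B' [BB' iB' dB']] := sparse_infinite_subset iB; exists B' => _.
by split=> //; exact: sparse_moiety dB'.
Qed.

(** C is the target of the shuffles along the sparse members of a reaping family. *)
Lemma dd_le_reaping X Y (C : set nat) : moiety C ->
  (forall A B : set nat, moiety A -> moiety B -> X (density R A) ->
    has_density B (0 : R) -> finite_set (B `\` A) \/ finite_set (B `&` A) ->
    Y (density R (shuffle B C @` A)) /\ density R (shuffle B C @` A) <> density R A) ->
  (dd X Y <= reaping_number)%O.
Proof.
move=> mC XY; apply: least_size_ge.
  by exists [set B | infinite_set B]; split=> // A iA; exists A => //; left; rewrite setDv.
move=> F [iF FA]; have [s sP] := reaping_sparse.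
pose f (B : nat -> Prop) := shuffle (s B) C.
apply: (@dd_le _ _ _ (@image (nat -> Prop) (nat -> nat) F f)); last first.
  rewrite -[X in (_ <= X)%O]/(@Defs.card (nat -> Prop) F); exact: card_image_leq.
split=> [_ [B /iF/sP[_ mB _] <-]|A iA iA' XA]; first exact: shuffle_bij.
have [B FB BA] := FA A iA; have [sB mB dB] := sP _ (iF _ FB).
exists (f B); first by exists B.
apply: XY => //; case: BA => [BA|BA]; [left|right]; apply: sub_finite_set BA.
  exact: setSD.
exact: setSI.
Qed.

(** What is not in B lands in the squares. *)
Lemma shuffle_sparse_image (A B : set nat) : moiety B -> finite_set (B `&` A) ->
  has_density (shuffle B (~` squares) @` A) (0 : R).
Proof.
move=> mB fBA; have mC := moietyC (squares_moiety R).
have bs := shuffle_bij mB mC.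
have [K HK] := finite_cnt (finite_image (shuffle B (~` squares)) fBA).
apply: (has_density0_le (K := K) (@squares_sparse R)) => n.
apply: leq_trans (_ : cnt (squares `|` `I_K) n <= _)%N.
  apply: sub_cnt => _ [a Aa <-].
  have [Ba|nBa] := pselect (B a); first by right; apply: HK; exists a.
  left; apply: contrapT => nsq.
  have : (shuffle B (~` squares) @` B) (shuffle B (~` squares) a) by rewrite shuffle_image.
  by move=> [b Bb /(bij_inj bs) ba]; apply: nBa; rewrite -ba.
apply: leq_trans (cntU _ _ _) _; rewrite leq_add2l.
by apply: (cnt_le_image (g := id)) => i _ iK; exists i.
Qed.

Lemma shuffle_sparse_ends (A B : set nat) : moiety B ->
  finite_set (B `\` A) \/ finite_set (B `&` A) ->
  ends01 R (density R (shuffle B (~` squares) @` A)).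
Proof.
move=> mB [BA|BA]; last by left; apply/densityP; exact: shuffle_sparse_image.
have mC := moietyC (squares_moiety R); have bs := shuffle_bij mB mC.
right; apply/densityP; rewrite -[_ @` A]setCK -image_setC// -[1]subr0.
by apply: has_densityC; apply: shuffle_sparse_image.
Qed.

Lemma dd_ends_le_reaping X : (forall d, X d -> ~ ends01 R d) ->
  (dd X (ends01 R) <= reaping_number)%O.
Proof.
move=> XE; apply: (dd_le_reaping (moietyC (squares_moiety R))) => A B mA mB XA _ BA.
have E := shuffle_sparse_ends mB BA; split=> // e; apply: XE XA _; by rewrite -e.
Qed.

(** Spreading a sparse set out over the evens halves the density of a set that
    almost misses it. *)
Lemma shuffle_evens_image (A B : set nat) (x : R) : moiety B -> has_density B (0 : R) ->
  has_density A x -> finite_set (B `&` A) ->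
  has_density (shuffle B [set n | ~~ odd n] @` A) (x / 2).
Proof.
move=> mB B0 Ax fBA; pose C : set nat := [set n | ~~ odd n].
have mC : moiety C := evens_moiety.
have bs := shuffle_bij mB mC.
have cC n : (n <= 2 * cnt (~` C) n + 1 <= n + 1)%N.
  have t0 m : (m.*2 \in ~` C) = false.
    by apply/negbTE/negP => /set_mem; apply; rewrite /C /= odd_double.
  have t1 m : (m.*2.+1 \in ~` C) = true.
    by apply/mem_set; rewrite /C /= odd_double.
  have H m : cnt (~` C) m.*2 = m.
    by elim: m => // m IHm; rewrite doubleS !cntS IHm t0 t1 addn0 addn1.
  rewrite -(odd_double_half n); move: (odd n) (n./2) => b k.
  by case: b; rewrite ?add1n ?add0n ?cntS H ?t0; lia.
have A'x : has_density (A `\` B) x.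
  apply: (has_density_perturb (B := A) B0) Ax; first by move=> i [Ai _]; left.
  by move=> i Ai; have [?|?] := pselect (B i); [right|left].
have [K HK] := finite_cnt (finite_image (shuffle B C) fBA).
have x01 := has_density_itv Ax.
move=> e e0; pose d := Num.min (e / 8) 2^-1.
have d0 : 0 < d by rewrite lt_min; apply/andP; split; lra.
have d1 : d <= 2^-1 by rewrite ge_min lexx orbT.
have d2 : d <= e / 8 by rewrite ge_min lexx.
have [L1 HL1] := A'x d d0; have [L2 HL2] := B0 d d0.
have [L3 HL3] := natr_unbounded ((K%:R + 1) / (e / 4)).
exists (maxn (2 * maxn L1 L2 + 1) L3) => n nL.
have n3 : K%:R + 1 <= e / 4 * n%:R.
  by rewrite mulrC -ler_pdivrMr; [apply: HL3; lia|lra].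
pose k := cnt (~` C) n; have [Bk ck] := eltP k mB.2; set N := elt (~` B) k in Bk ck.
have kN : (k <= N)%N by rewrite -{1}ck cnt_le.
have kn := cC n; rewrite -/k in kn.
have c2 : cnt (shuffle B C @` (A `\` B)) n = cnt (A `\` B) N.
  by apply: cnt_shuffleD => //; rewrite ck.
have c3 : (cnt (shuffle B C @` A) n <= cnt (A `\` B) N + K)%N.
  rewrite -c2; apply: leq_trans (_ : cnt (shuffle B C @` (A `\` B) `|` `I_K) n <= _)%N.
    apply: sub_cnt => _ [a Aa <-].
    by have [Ba|nBa] := pselect (B a); [right; apply: HK; exists a|left; exists a].
  apply: leq_trans (cntU _ _ _) _; rewrite leq_add2l.
  by apply: (cnt_le_image (g := id)) => i _ iK; exists i.
have c4 : (cnt (A `\` B) N <= cnt (shuffle B C @` A) n)%N.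
  by rewrite -c2; apply: sub_cnt => _ [a [Aa _] <-]; exists a.
have NL : (maxn L1 L2 <= N)%N by lia.
have {}HL1 := HL1 N (leq_trans (leq_maxl _ _) NL).
have {HL2} := HL2 N (leq_trans (leq_maxr _ _) NL).
rewrite mul0r subr0 ger0_norm// => HL2.
have NE : N%:R = k%:R + (cnt B N)%:R :> R by rewrite -natrD -ck addnC cntC.
move: c3 c4 kn => + + /andP[]; rewrite -!(ler_nat R) !(natrM, natrD).
move: HL1; rewrite !ler_norml => /andP[].
set cN := (cnt (A `\` B) N)%:R; set cn := (cnt _ n)%:R.
move: NE HL2 n3; set bN := (cnt B N)%:R.
have : 0 <= bN by []; have : 0 <= N%:R :> R by []; have : 0 <= n%:R :> R by [].
have : 0 <= k%:R :> R by [].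
move: N%:R k%:R n%:R K%:R bN cN cn x01 d0 d1 d2 e0.
move=> N' k' n' K' bN cN cn /andP[x0 x1] d0 d1 d2 e0 k0 n0 N0 b0 NE bd Ke h1 h2 h3 h4 h5 h6.
have N2 : N' <= 2 * k' by nra.
have dN : d * N' <= e / 8 * n' by nra.
have xN : x * n' / 2 - x <= x * N' by nra.
have xN' : x * N' <= x * n' / 2 + d * N' by nra.
apply/andP; split; lra.
Qed.

Lemma dd_Ioo_le_reaping : (dd (Ioo01 R) (Ioo01 R) <= reaping_number)%O.
Proof.
apply: (dd_le_reaping evens_moiety) => A B mA mB [x + xA] B0 BA.
have Ax : has_density A x by exact/densityP.
rewrite -xA /= in_itv /= => /andP[x0 x1]; case: BA => BA.
  have -> : density R (shuffle B [set n | ~~ odd n] @` A) = Some (1 - (1 - x) / 2).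
    apply/densityP; rewrite -[_ @` A]setCK -image_setC; last exact: shuffle_bij evens_moiety.
    apply: has_densityC; apply: shuffle_evens_image => //; exact: has_densityC.
  by split=> [|[]]; [apply/in_Ioo01|]; lra.
have -> : density R (shuffle B [set n | ~~ odd n] @` A) = Some (x / 2).
  by apply/densityP; exact: shuffle_evens_image.
by split=> [|[]]; [apply/in_Ioo01|]; lra.
Qed.
End Reaping.

(** * The lower bound non(M) *)

Section Guessing.
Variable s : nat -> nat.

(** The terms of s are read as codes of finite partial functions. *)
Definition candidate N : seq (nat * nat) := odflt [::] (unpickle (s N)).

(** From each candidate in turn, one pair is taken whose argument has no value yet. *)
Fixpoint picked N : seq (nat * nat) :=
  if N is M.+1 then
    take 1 [seq ab <- candidate M | ab.1 \notin map fst (picked M)] ++ picked M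
  else [::].

Definition guess a : nat := xget 0 [set b | exists N, (a, b) \in picked N].

Lemma pickedS M N : M <= N -> {subset picked M <= picked N}.
Proof.
move=> MN; rewrite -(subnK MN); elim: (N - M) => // i IHi ab /IHi.
by rewrite addSn /= mem_cat => ->; rewrite orbT.
Qed.

Lemma size_picked N : size (picked N) <= N.
Proof. by elim: N => // N IHN; rewrite /= size_cat size_take; case: ifP; lia. Qed.

Lemma picked_uniq N : uniq (map fst (picked N)).
Proof.
elim: N => // N IHN /=; case E: [seq ab <- candidate N | ab.1 \notin map fst (picked N)] 
  => [|ab l] //=.
rewrite take0 /= IHN andbT.
have : ab \in ab :: l by exact: mem_head.
by rewrite -E mem_filter => /andP[].
Qed.

Lemma guessE a b N : (a, b) \in picked N -> guess a = b.
Proof.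
move=> abN; have [M] := xgetPex 0 (P := [set b | exists N, (a, b) \in picked N])
  (ex_intro _ b (ex_intro _ N abN)).
rewrite -/(guess a) => aM.
have /(pickedS (leq_maxl N M)) h1 := abN; have /(pickedS (leq_maxr N M)) h2 := aM.
have := picked_uniq (maxn N M); elim: (picked _) h1 h2 => // -[c d] l IHl /=.
rewrite !inE => h1 h2 /andP[cl ul].
case/predU1P: h1 => [[ac bd]|h1]; case/predU1P: h2 => [[ac' gd]|h2]; last exact: IHl.
- by rewrite gd bd.
- by move: cl; rewrite -ac => /negP[]; apply/mapP; exists (a, guess a).
- by move: cl; rewrite -ac' => /negP[]; apply/mapP; exists (a, b).
Qed.

(** A candidate that is longer than its index cannot have been exhausted, so one
    of its values is guessed. *)
Lemma guess_candidate (u : seq (nat * nat)) N : s N = pickle u -> uniq (map fst u) ->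
  N < size u -> exists2 ab, ab \in u & guess ab.1 = ab.2.
Proof.
move=> sN uu Nu; have cN : candidate N = u by rewrite /candidate sN pickleK.
have [/hasP[ab abu abN]|] := boolP (has (fun ab => ab.1 \notin map fst (picked N)) u).
  case E: [seq ab <- u | ab.1 \notin map fst (picked N)] => [|cd l].
    by have : ab \in [::] by rewrite -E mem_filter abN.
  have : cd \in cd :: l by exact: mem_head.
  rewrite -E mem_filter => /andP[_ cdu]; exists cd => //; apply: (@guessE _ _ N.+1).
  by rewrite /= cN E /= -surjective_pairing mem_head.
rewrite -all_predC => /allP H; suff : size u <= N by lia.
apply: leq_trans (size_picked N); rewrite -(size_map fst u) -(size_map fst (picked N)).
apply: uniq_leq_size => // a /mapP[ab /H /= + ->].
by rewrite negbK.
Qed.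
End Guessing.

Section NonMeager.
Variables (P : set (nat -> nat)) (s : (nat -> nat) -> nat -> nat) (h : nat -> nat).
Hypothesis sP : forall g : nat -> nat, exists2 p, P p &
  forall K, exists2 n, K <= n & exists2 N, N < h n & s p N = g n.

(** The value at n of the function to be captured codes g on h(n) + 1 elements of D
    beyond n, more than the number of candidates examined until it is found. *)
Lemma guess_infinitely (g : nat -> nat) (D : set nat) : infinite_set D ->
  exists2 p, P p & forall K, exists a, [/\ K <= a, D a & guess (s p) a = g a].
Proof.
move=> iD; pose u n := mkseq (fun i => (elt D (n + i), g (elt D (n + i)))) (h n).+1.
have [p Pp sp] := sP (fun n => pickle (u n)); exists p => // K.
have [n Kn [N Nh sN]] := sp K.
have [||ab /mapP[i _ ->] /= E] := guess_candidate sN.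
- rewrite -map_comp map_inj_uniq ?iota_uniq// => i j /= /(congr1 (cnt D)).
  by have [_ ->] := eltP (n + i) iD; have [_ ->] := eltP (n + j) iD; lia.
- by rewrite size_mkseq; lia.
exists (elt D (n + i)); split=> //; last by have [] := eltP (n + i) iD.
by have := elt_ge (n + i) iD; lia.
Qed.

(** An interval partition such that f on a block is bounded by the end of the next
    one. *)
Definition frontier (f : nat -> nat) := fix j k :=
  if k is l.+1 then (j l + \max_(i < (j l).+1) f i).+1 else 0.

Lemma frontierS f k : frontier f k < frontier f k.+1.
Proof. by rewrite /= ltnS leq_addr. Qed.

Lemma frontier_gt f k i : i <= frontier f k -> f i < frontier f k.+1.
Proof.
move=> ik; rewrite /= ltnS; apply: leq_trans (leq_addl _ _).
by rewrite -ltnS in ik; rewrite (leq_bigmax (Ordinal ik)).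
Qed.

(** If f meets the twice iterated G at a point of some block, then this block or
    the next one reaches beyond the value of G at its left end. *)
Lemma frontier_guess (G : nat -> nat) : exists2 p, P p &
  forall K, exists2 k, K <= k &
    G (frontier (guess (s p)) k) <= frontier (guess (s p)) k.+1.
Proof.
pose H n := n + \max_(i < n.+1) G i.
have GH m n : m <= n -> G m <= H n.
  move=> mn; apply: leq_trans (leq_addl _ _).
  by rewrite -ltnS in mn; rewrite (leq_bigmax (Ordinal mn)).
have [p Pp pH] := guess_infinitely (fun n => H (H n)) infinite_nat.
exists p => // K; set j := frontier _; have jS : forall k, j k < j k.+1 := frontierS _.
have [m [jm _ fm]] := pH (j K).
have [|k /andP[km mk]] := block_exists jS (i := m); first by [].
have Kk : K <= k.
  by rewrite leqNgt; apply/negP => /(incr_le jS); rewrite leqNgt => /negP; lia.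
have [Hk|kH] := leqP (H m) (j k.+1); first by exists k => //; have := GH _ _ km; lia.
exists k.+1; first by lia.
apply: leq_trans (GH _ _ (ltnW kH)) _; rewrite -fm ltnW//.
by apply: frontier_gt; exact: ltnW.
Qed.

(** On each block of the partition guessed by the first component, the bits are the
    word guessed by the second component for this block. *)
Definition guessed_sequence (pp : (nat -> nat) * (nat -> nat)) (i : nat) : bool :=
  let j := frontier (guess (s pp.1)) in
  let k := xget 0 [set k | j k <= i < j k.+1] in
  nth false (odflt [::] (unpickle (guess (s pp.2) k))) (i - j k).

(** Let the words W witness that a set is meager. The first guess provides
    infinitely many blocks long enough for the words at their left ends, the second
    guess finds infinitely many of these words. *)
Lemma guessed_sequences_nonmeager : ~ meager (guessed_sequence @` (P `*` P)).
Proof.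
move=> /meagerP[W SW].
have [p1 Pp1 H1] := frontier_guess (fun n => n + size (W n)).
set j := frontier _ in H1.
have iD : infinite_set [set k | j k + size (W (j k)) <= j k.+1].
  by apply/infinite_ge => K; have [k Kk jk] := H1 K; exists k.
have [p2 Pp2 H2] := guess_infinitely (fun k => pickle (W (j k))) iD.
have [|N yN] := SW (guessed_sequence (p1, p2)); first by exists (p1, p2).
have [k [Nk jk fk]] := H2 N; have {}jk : j k + size (W (j k)) <= j k.+1 := jk.
have jS : forall k, j k < j k.+1 := frontierS _.
apply: (yN (j k)) => [|i iW]; first by have := incr_ge jS k; lia.
have ki : j k <= j k + i < j k.+1.
  by apply/andP; split; [exact: leq_addr|apply: leq_trans jk; rewrite ltn_add2l].
have {}fk : guess (s p2) k = pickle (W (j k)) := fk.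
have kE : xget 0 [set l | j l <= j k + i < j l.+1] = k.
  apply: (block_uniq jS _ ki).
  exact: (xgetPex 0 (P := [set l | j l <= j k + i < j l.+1]) (ex_intro _ k ki)).
by rewrite /guessed_sequence [xget _ _]kE fk pickleK [odflt _ _]/= addKn.
Qed.

Lemma non_meager_le : infinite_set P -> (non meager <= Defs.card P)%O.
Proof.
move=> iP; apply: (least_size_le (F := guessed_sequence @` (P `*` P))).
  exact: guessed_sequences_nonmeager.
rewrite -[X in (X <= _)%O]/(@Defs.card (nat -> bool) (guessed_sequence @` (P `*` P))).
rewrite cardinal_leE; apply: card_le_trans (card_image_le _ _) _.
exact: card_square.
Qed.
End NonMeager.

Section NonMeagerDensity.
Variable R : realType.

(** If p(g n) and g n are at least n^2 for all large n and all p in P, then the range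
    of g and its images have density zero, so P fails. Otherwise g is captured by the
    enumerations that list the preimages under p alternately with all numbers. *)
Lemma non_meager_le_witness Y P : witness (ends01 R) Y P -> (non meager <= Defs.card P)%O.
Proof.
move=> [Psym PP].
have /choice[s sP] p : exists s : nat -> nat, forall q, cancel p q -> cancel q p ->
    forall i, s i.*2 = q i /\ s i.*2.+1 = i.
  have [[q qp pq]|np] := pselect (exists2 q, cancel q p & cancel p q); last first.
    by exists id => q pq qp; case: np; exists q.
  exists (fun n => if odd n then n./2 else q n./2) => q' pq' qp' i.
  have -> : q' i = q i by apply: (can_inj pq); rewrite qp' qp.
  by rewrite /= odd_double doubleK uphalf_double.
have sg (g : nat -> nat) : exists2 p, P p &
    forall K, exists2 n, K <= n & exists2 N, N < (n * n).*2 & s p N = g n.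
  apply: contrapT => H.
  have {H}gP p : P p -> exists K, forall n, K <= n -> n * n <= g n /\ n * n <= p (g n).
    move=> Pp; apply: contrapT => nK; apply: H; exists p => // K.
    apply: contrapT => nn; apply: nK; exists K => n Kn.
    have [q pq qp] := Psym _ Pp; have sq := sP p q pq qp.
    split; rewrite leqNgt; apply/negP => lt; apply: nn; exists n => //.
      by exists (g n).*2.+1; [lia|have [] := sq (g n)].
    by exists (p (g n)).*2; [lia|have [-> _] := sq (p (g n)); rewrite pq].
  have [A [iA iA'] A0] : exists2 A, moiety A & density R A = Some 0%R.
    by apply: every_density_realized; apply/Icc01_all/ends01_Icc01; left.
  have [|p0 Pp0 _] := PP A iA iA'; first by left.
  have [K gK] := gP _ Pp0.
  have ig : infinite_set (range g).
    apply/infinite_ge => k; exists (g (maxn K k.+1)); last by exists (maxn K k.+1).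
    by have [] := gK _ (leq_maxl K k.+1); nia.
  have g0 : has_density (range g) (0 : R)%R.
    apply: (has_density0_fast (g := g)); last exact: subset_refl.
    by exists K => n /gK[].
  have [_ ig'] := sparse_moiety ig g0.
  have dg : density R (range g) = Some 0%R by apply/densityP.
  have [|p Pp [_]] := PP _ ig ig'; first by rewrite dg; left.
  rewrite dg; apply; apply/densityP.
  apply: (has_density0_fast (g := p \o g)); last by rewrite image_comp; exact: subset_refl.
  by have [L gL] := gP _ Pp; exists L => n /gL[].
apply: (non_meager_le sg) => fP.
have /choice[g gs] n : exists m, forall p N, P p -> N < (n * n).*2 -> s p N < m.
  have /finite_cnt[m mP] := finite_image (fun pN => s pN.1 pN.2)
    (finite_setX fP (finite_II (n * n).*2)).
  by exists m => p N Pp Nn; apply: mP; exists (p, N).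
have [p Pp /(_ 0)[n _ [N Nn sN]]] := sg g.
by have := gs n p N Pp Nn; rewrite sN ltnn.
Qed.
End NonMeagerDensity.

(** * The lower bound continuum *)

Lemma cntUI (A B : set nat) n : cnt A n + cnt B n = cnt (A `|` B) n + cnt (A `&` B) n.
Proof.
elim: n => // n; rewrite !cntS in_setU in_setI.
by case: (_ \in A); case: (_ \in B) => /=; lia.
Qed.

(** Induction on the sequence: a new set meets the union of the previous ones in a
    finite set. *)
Lemma almost_disjoint_cnt (T : eqType) (B : T -> set nat) (xs : seq T) : uniq xs ->
  {in xs &, forall x y, x != y -> finite_set (B x `&` B y)} ->
  exists K, forall n, \sum_(x <- xs) cnt (B x) n <= n + K.
Proof.
move=> uxs BI; pose U (xs : seq T) : set nat := [set i | exists2 x, x \in xs & B x i].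
suff [K KP] : exists K, forall n, \sum_(x <- xs) cnt (B x) n <= cnt (U xs) n + K.
  by exists K => n; apply: leq_trans (KP n) _; rewrite leq_add2r cnt_le.
elim: xs uxs BI => [|x xs IHxs] /=; first by exists 0 => n; rewrite big_nil.
move=> /andP[xxs uxs] BI; have [|K KP] := IHxs uxs.
  by move=> y z yxs zxs; apply: BI; rewrite inE ?yxs ?zxs orbT.
have /finite_cnt[L HL] : finite_set (B x `&` U xs).
  have -> : B x `&` U xs = \bigcup_(y in [set` xs]) (B x `&` B y).
    apply/seteqP; split=> [i [Bx [y yxs By]]|i [y /= yxs [Bx By]]]; first by exists y.
    by split=> //; exists y.
  apply: bigcup_finite; first exact: finite_seq.
  move=> y /= yxs; apply: BI; rewrite ?mem_head ?inE ?yxs ?orbT//.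
  by apply: contraNneq xxs => ->.
exists (L + K) => n; rewrite big_cons.
have := cntUI (B x) (U xs) n; have := KP n.
have : cnt (B x `&` U xs) n <= L by apply: (cnt_le_image (g := id)) => i _ /HL; exists i.
have : cnt (B x `|` U xs) n <= cnt (U (x :: xs)) n; last by lia.
apply: sub_cnt => i [Bx|[y yxs By]]; first by exists x; rewrite ?mem_head.
by exists y; rewrite // inE yxs orbT.
Qed.

(** The diagonal sequence. *)
Lemma uncountable_cantor : ~ countable [set: nat -> bool].
Proof.
move=> /countable_injP[e eI]; pose d n := ~~ xget (fun=> false) [set x | e x = n] n.
have := xgetPex (fun=> false) (P := [set x | e x = e d]) (ex_intro _ d erefl).
set x := xget _ _ => /eI; rewrite !in_setE => /(_ I I) xd.
by have : d (e d) = ~~ x (e d); [|rewrite xd; case: (d _)].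
Qed.

Section Continuum.
Variable R : realType.

Lemma positive_density_linear (A : set nat) (r : R) : has_density A r -> (0 < r)%R ->
  exists M, forall n, M <= n -> n <= M * cnt A n.
Proof.
move=> Ar r0; have [|K Kn] := Ar (r / 2)%R; first by lra.
have [N Nn] := natr_unbounded (r / 2)^-1%R; exists (maxn K N) => n nK.
rewrite -(ler_nat R) natrM; have := Kn n (leq_trans (leq_maxl _ _) nK).
have := Nn _ (leq_maxr K N); move: (maxn K N) => M.
rewrite -div1r ler_pdivrMr; last by lra.
rewrite ler_norml => rM /andP[+ _].
have : (0 <= n%:R :> R)%R by [].
have : (0 <= M%:R :> R)%R by [].
nra.
Qed.

(** Almost disjoint sets cannot all be blown up by the same permutation: at most
    countably many of the images have a positive density. *)
Lemma continuum_le (P : set (nat -> nat)) (A : (nat -> bool) -> set nat) :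
  P `<=` Defs.Sym -> (forall x y, x <> y -> finite_set (A x `&` A y)) ->
  (forall x, exists2 p, P p & exists2 r : R, (0 < r)%R & has_density (p @` A x) r) ->
  (continuum <= Defs.card P)%O.
Proof.
move=> Psym AI PA.
have /choice[F FP] x : exists p, P p /\ exists M, forall n, M <= n -> n <= M * cnt (p @` A x) n.
  by have [p Pp [r r0 /positive_density_linear/(_ r0)]] := PA x; exists p.
have fib u : countable ([set: nat -> bool] `&` F @^-1` [set u]).
  pose Z M := [set x | F x = u /\ forall n, M <= n -> n <= M * cnt (u @` A x) n].
  apply: (@sub_countable _ _ _ (\bigcup_M Z M)).
    apply: subset_card_le => x [_ /= Fx]; have [_ [M MP]] := FP x.
    by exists M => //; split=> //; rewrite -Fx.
  apply: bigcup_countable => // M _; apply: finite_set_countable.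
  apply: contrapT => /(@infinite_set_fset _ _ (M.*2.+1))[X XZ Xsz].
  have [||K KP] := @almost_disjoint_cnt _ (fun x => u @` A x) (finmap.enum_fset X).
  - exact: finmap.fset_uniq.
  - move=> x y xX yX /eqP xy; have [Fx _] := XZ _ xX; have [Px _] := FP x.
    rewrite -bij_imageI; last by rewrite -Fx; exact: Psym.
    by apply: finite_image; exact: AI.
  pose n := (maxn M K).+1.
  have : M.*2.+1 * n <= M * (n + K).
    apply: leq_trans (_ : M * \sum_(x <- finmap.enum_fset X) cnt (u @` A x) n <= _)%N; last first.
      by rewrite leq_mul2l KP orbT.
    apply: leq_trans (_ : size (finmap.enum_fset X) * n <= _)%N.
      by rewrite leq_mul2r Xsz orbT.
    rewrite -sum1_size big_distrl big_distrr /= big_seq [leqRHS]big_seq.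
    apply: leq_sum => x xX; rewrite mul1n.
    by have [_] := XZ _ xX; apply; rewrite /n; lia.
  by rewrite /n; nia.
rewrite /continuum cardinal_leE.
have [fP|iP] := pselect (finite_set P).
  exfalso; apply: uncountable_cantor.
  have -> : [set: nat -> bool] = \bigcup_(u in P) ([set: nat -> bool] `&` F @^-1` [set u]).
    by apply/seteqP; split=> // x _; exists (F x) => //; have [] := FP x.
  by apply: bigcup_countable => //; exact: finite_set_countable.
by apply: (card_le_countable_fibers iP _ fib) => x _; have [] := FP x.
Qed.
End Continuum.

Section ContinuumDensity.
Variable R : realType.

Lemma Sym_le_continuum : (Defs.card Defs.Sym <= continuum)%O.
Proof.
rewrite cardinal_leE; apply/(card_leP_fun (fun=> false)).
exists (fun (f : nat -> nat) n => if unpickle n is Some (a, b) then f a == b else false).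
split=> // f g _ _ fg; apply/funext => a.
by have := congr1 (fun h => h (pickle (a, f a))) fg; rewrite pickleK eqxx => /esym/eqP.
Qed.

Lemma dd_le_continuum X Y : dd_defined X Y -> (@dd R X Y <= continuum)%O.
Proof. by move=> d; apply: dd_le (Sym_witness d) Sym_le_continuum. Qed.

(** The codes of the initial segments of x: different sequences have almost disjoint
    branches. *)
Definition branch (x : nat -> bool) : set nat := range (fun n => pickle (mkseq x n)).

Lemma branch_infinite x : infinite_set (branch x).
Proof.
rewrite /branch (@eq_finite_set _ _ _ [set: nat]); first exact: infinite_nat.
apply: inj_card_eq => m n _ _ /(pcan_inj pickleK)/(congr1 size).
by rewrite !size_mkseq.
Qed.

Lemma branchI x y : x <> y -> finite_set (branch x `&` branch y).
Proof.
move=> xy; have [i xyi] : exists i, x i <> y i.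
  by apply: contrapT => H; apply: xy; apply/funext => i; apply: contrapT => nxy; apply: H; exists i.
apply: (sub_finite_set _ (finite_image (fun n => pickle (mkseq x n)) (finite_II i.+1))).
move=> _ [[n _ <-] [m _ /(pcan_inj pickleK) mn]]; exists n => //=.
rewrite ltnS leqNgt; apply/negP => lt; apply: xyi.
have nm : m = n by rewrite -(size_mkseq y m) mn size_mkseq.
by rewrite -(nth_mkseq false x lt) -mn nm nth_mkseq.
Qed.

Lemma branch_moiety x : moiety (branch x).
Proof.
split; first exact: branch_infinite.
pose y i := ~~ x i; have /branchI fI : x <> y.
  by move=> /(congr1 (fun f => f 0)); rewrite /y; case: (x 0).
apply: (sub_infinite_set _ (infinite_setD (@branch_infinite y) fI)) => i [yi nxy] xi.
exact: nxy.
Qed.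

(** The squares of the elements of the branches are almost disjoint sets of density
    zero. *)
Lemma continuum_le_ends Y P : Y `<=` all_densities R -> ~ Y (osc R) ->
  witness (ends01 R) Y P -> (continuum <= Defs.card P)%O.
Proof.
move=> Yall nY [Psym PP].
apply: (@continuum_le R P (fun x => (fun k => k * k) @` branch x)) => // [x y /branchI fI|x].
  apply: (sub_finite_set _ (finite_image (fun k => k * k) fI)).
  move=> _ [[k kx <-] [l ly lk]]; exists k => //; split=> //.
  by have -> : k = l by nia.
set A := _ @` _.
have A0 : has_density A (0 : R)%R.
  apply: has_density_sub0 (@squares_sparse R) => _ [k _ <-]; by exists k.
have iA : infinite_set A.
  have /infinite_ge ib := @branch_infinite x.
  apply/infinite_ge => k; have [i ki bi] := ib k; exists (i * i); last by exists i.
  by nia.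
have dA : density R A = Some 0%R by apply/densityP.
have [_ iA'] := sparse_moiety iA A0.
have [|p Pp [Yp]] := PP A iA iA'; first by rewrite dA; left.
rewrite dA => np; exists p => //.
case: (Yall _ Yp) => [[r + rp]|po]; last by case: nY; rewrite -po.
rewrite /= in_itv /= => /andP[r0 _]; exists r; last exact/densityP.
by rewrite lt_neqAle r0 andbT; apply/eqP => r00; apply: np; rewrite -rp -r00.
Qed.

(** Unions of rapidly growing blocks along the branches are almost disjoint sets that
    oscillate. *)
Lemma continuum_le_osc P : witness [set osc R] (Ioo01 R) P -> (continuum <= Defs.card P)%O.
Proof.
move=> [Psym PP].
pose F m := (m * m + m).+1.
pose j := fix j k := if k is l.+1 then F (j l) else 0%N.
have jS k : (j k < j k.+1)%N by rewrite /= ltnS leq_addl.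
apply: (@continuum_le R P (fun x => blocks j (branch x))) => // [x y /branchI fI|x].
  exact: (sub_finite_set (@blocksI _ jS _ _) (blocks_finite jS fI)).
have st : stretchy F (blocks j (branch x)).
  by apply: (blocks_stretchy jS (branch_moiety x)); exists 0.
have [iA iA'] : moiety (blocks j (branch x)).
  by apply: stretchy_moiety st => m; rewrite /F; lia.
have Ao : density R (blocks j (branch x)) = osc R.
  by apply: stretchy_osc st => m; rewrite /F; lia.
have [p Pp [[r + rp] _]] := PP _ iA iA' Ao.
rewrite /= in_itv /= => /andP[r0 _].
by exists p => //; exists r => //; apply/densityP.
Qed.

Lemma dd_defined_osc_Ioo : dd_defined [set osc R] (Ioo01 R).
Proof.
split=> [_ ->|d /Ioo01_Icc01/Icc01_all//||_ ->]; [by right|by exists (osc R)|].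
by exists (Some 2^-1)%R => //; exact: half_Ioo01.
Qed.

Lemma dd_ends_continuum Y : dd_defined (ends01 R) Y -> ~ Y (osc R) ->
  (continuum <= dd (ends01 R) Y)%O.
Proof.
by move=> d nY; apply: dd_ge => // P; apply: continuum_le_ends => //; case: d.
Qed.

Lemma dd_osc_continuum : dd [set osc R] (Ioo01 R) = continuum.
Proof.
apply: le_anti; apply/andP; split.
  by apply: dd_le_continuum; exact: dd_defined_osc_Ioo.
by apply: dd_ge => [|P]; [exact: dd_defined_osc_Ioo|exact: continuum_le_osc].
Qed.
End ContinuumDensity.

(** * Null sets *)

Section NullSets.
Variable R : realType.
Local Open Scope ring_scope.

Definition weight (L : seq (seq bool)) : R := \sum_(s <- L) 2^-1 ^+ size s.

Lemma weight_cat L L' : weight (L ++ L') = weight L + weight L'.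
Proof. by rewrite /weight big_cat. Qed.

Lemma weight_flatten (T : Type) (F : T -> seq (seq bool)) (l : seq T) :
  weight (flatten [seq F i | i <- l]) = \sum_(i <- l) weight (F i).
Proof.
elim: l => [|i l IHl] /=; first by rewrite /weight !big_nil.
by rewrite weight_cat IHl big_cons.
Qed.

Lemma sum_halves N k : \sum_(i < k) (2^-1 : R) ^+ (N + i) <= 2 * 2^-1 ^+ N.
Proof.
suff -> : \sum_(i < k) (2^-1 : R) ^+ (N + i) = 2 * 2^-1 ^+ N - 2 * 2^-1 ^+ (N + k).
  by rewrite gerBl mulr_ge0// exprn_ge0// invr_ge0.
elim: k => [|k IHk]; first by rewrite big_ord0 addn0 subrr.
rewrite big_ord_recr /= IHk addnS exprS; lra.
Qed.

(** Nullity in Borel-Cantelli form: being covered infinitely often by finite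
    unions of cylinders of summable measures. This form is closed under
    countable unions with little effort. *)
Definition limsup_null (A : set (nat -> bool)) := exists L : nat -> seq (seq bool),
  (forall n, weight (L n) <= 2^-1 ^+ n) /\
  forall x, A x -> forall K, exists2 n, (K <= n)%N & exists2 s, s \in L n & cylinder s x.

(** The n-th list collects from the m-th cover, for each m up to n, a list so late
    that the measures add up to at most 2^-n. *)
Lemma limsup_null_bigcup (A : nat -> set (nat -> bool)) :
  (forall m, limsup_null (A m)) -> limsup_null (\bigcup_m A m).
Proof.
move=> /choice[L LA]; exists (fun n => flatten [seq L m (n.+1 + m)%N | m <- iota 0 n.+1]).
split=> [n|x [m _ Amx] K].
  rewrite weight_flatten; apply: (@le_trans _ _ (\sum_(m <- iota 0 n.+1) 2^-1 ^+ (n.+1 + m))).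
    by apply: ler_sum => m _; exact: (LA m).1.
  rewrite -[iota _ _]/(index_iota 0 n.+1) big_mkord; apply: le_trans (sum_halves _ _) _.
  by rewrite exprS mulrA mulfV ?mul1r.
have [n nK [s sL sx]] := (LA m).2 x Amx (K + m + m).+1.
exists (n - m.+1)%N; first by lia.
exists s => //; apply/flatten_mapP; exists m; first by rewrite mem_iota; lia.
by have -> : ((n - m.+1).+1 + m = n)%N by lia.
Qed.

Lemma limsup_nullS A B : A `<=` B -> limsup_null B -> limsup_null A.
Proof. by move=> AB [L [Lw LB]]; exists L; split=> // x /AB; exact: LB. Qed.

Lemma limsup_nullU A B : limsup_null A -> limsup_null B -> limsup_null (A `|` B).
Proof.
move=> nA nB; apply: (@limsup_nullS _ (\bigcup_m (if m is 0%N then A else B))).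
  by move=> x [Ax|Bx]; [exists 0%N|exists 1%N].
by apply: limsup_null_bigcup => -[|m].
Qed.

(** The tail of the cover, listed as one sequence of cylinders; partial sums suffice
    because each is bounded by that of a whole number of lists. *)
Lemma limsup_null_cover A N : limsup_null A -> exists s : nat -> seq bool,
  (forall k, \sum_(i < k) 2^-1 ^+ size (s i) <= 4 * 2^-1 ^+ N :> R) /\
  forall x, A x -> exists k, cylinder (s k) x.
Proof.
move=> [L [Lw LA]].
(* A word of length n added to each list makes sure that none is empty. *)
pose F k := flatten [seq nseq (N + i) false :: L (N + i)%N | i <- iota 0 k].
have FS k l : (k <= l)%N -> exists G, F l = F k ++ G.
  move=> kl; exists (flatten [seq nseq (N + i) false :: L (N + i)%N | i <- iota k (l - k)]).
  by rewrite /F -{1}(subnKC kl) iotaD map_cat flatten_cat.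
have szF k : (k <= size (F k))%N.
  elim: k => // k; rewrite /F -addn1 iotaD map_cat flatten_cat size_cat /=.
  by rewrite size_cat /=; lia.
pose s k := nth [::] (F k.+1) k.
have sE k i : (i < size (F k))%N -> s i = nth [::] (F k) i.
  move=> ik; rewrite /s; have [|/ltnW] := leqP i.+1 k => /FS[G ->]; rewrite nth_cat ?ik//.
  by rewrite (leq_trans _ (szF i.+1)).
exists s; split=> [k|x /LA/(_ N)[n Nn [t tL tx]]].
  apply: (@le_trans _ _ (weight (F k))); last first.
    rewrite weight_flatten; apply: (@le_trans _ _ (\sum_(i <- iota 0 k) 2 * 2^-1 ^+ (N + i))).
      apply: ler_sum => i _; rewrite -cat1s weight_cat mulrDl !mul1r lerD ?Lw//.
      by rewrite /weight big_seq1 size_nseq.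
    have Ek : iota 0 k = index_iota 0 k by rewrite /index_iota subn0.
    rewrite -mulr_sumr Ek big_mkord.
    by have := sum_halves N k; lra.
  rewrite /weight -(cat_take_drop k (F k)) big_cat /= -[leLHS]addr0.
  apply: lerD; last by apply: sumr_ge0 => u _; rewrite exprn_ge0// invr_ge0.
  rewrite (big_nth [::]) size_takel ?szF// big_mkord; apply: ler_sum => i _.
  by rewrite nth_take// -(sE k)// (leq_trans (ltn_ord i)).
have tF : t \in F (n - N).+1.
  apply/flatten_mapP; exists (n - N)%N; first by rewrite mem_iota; lia.
  by rewrite subnKC// inE tL orbT.
by exists (index t (F (n - N).+1)); rewrite (sE (n - N).+1) ?index_mem// nth_index.
Qed.

Lemma limsup_null_null A : limsup_null A -> null R A.
Proof.
move=> AN; apply/eqP; rewrite eq_le; apply/andP; split; last first.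
  apply: le_ereal_inf_tmp => _ [s _ <-]; apply: nneseries_ge0 => k _ _.
  by rewrite lee_fin exprn_ge0// invr_ge0.
apply/lee_addgt0Pr => e e0; rewrite add0e.
have [N Ne] : exists N, 4 * 2^-1 ^+ N <= e.
  have [N Nn] := natr_unbounded (4 / e); exists N.
  rewrite exprVn ler_pdivrMr ?exprn_gt0//.
  have := Nn N (leqnn _); rewrite ler_pdivrMr// mulrC => h; apply: le_trans h _.
  rewrite ler_pM2l// -natrX ler_nat ltnW// ltn_expl//.
have [s [sw sA]] := limsup_null_cover N AN.
apply: ge_ereal_inf; exists (\sum_(0 <= k <oo) ((2^-1 : R) ^+ size (s k))%:E)%E.
  by exists s => // x /sA[k kx]; exists k.
apply: lime_le; first by apply: is_cvg_nneseries => k _ _; rewrite lee_fin exprn_ge0// invr_ge0.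
apply: nearW => k; rewrite sumEFin lee_fin big_mkord.
exact: le_trans (sw k) Ne.
Qed.

(** The measure of the cylinder of s relative to that of t. *)
Fixpoint relative_weight (t s : seq bool) : R :=
  match t, s with
  | [::], _ => 2^-1 ^+ size s
  | _, [::] => 1
  | a :: t', b :: s' => if a == b then relative_weight t' s' else 0
  end.

Lemma relative_weight_split t s : relative_weight t s =
  (relative_weight (rcons t false) s + relative_weight (rcons t true) s) / 2.
Proof.
elim: t s => [|a t IHt] [|b s] /=; rewrite ?expr0; try lra.
  by rewrite exprS; case: b => /=; lra.
by case: eqP => _; [exact: IHt|lra].
Qed.

Lemma relative_weight_ge0 t s : 0 <= relative_weight t s.
Proof.
elim: t s => [|a t IHt] [|b s] //=; last by case: eqP.
Qed.

Lemma relative_weight_id t : relative_weight t t = 1.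
Proof. by elim: t => [|a t IHt] /=; rewrite ?expr0 ?eqxx. Qed.

(** Bits are chosen one by one, so as to keep the relative measure of the cover
    small: the Cantor space is not null. *)
Lemma limsup_null_setT : ~ limsup_null setT.
Proof.
move=> /(limsup_null_cover 3)[s [sw sT]].
pose good t := forall k, \sum_(i < k) relative_weight t (s i) <= 2^-1.
have good0 : good [::] by move=> k; apply: le_trans (sw k) _; rewrite !exprS expr0; lra.
have goodS t : good t -> ~ good (rcons t false) -> good (rcons t true).
  move=> gt /existsNP[k /negP]; rewrite -ltNge => kb l; rewrite leNgt; apply/negP => lb.
  have mono u i j : (i <= j)%N ->
      \sum_(h < i) relative_weight u (s h) <= \sum_(h < j) relative_weight u (s h).
    move=> ij; rewrite -(subnK ij); elim: (j - i)%N => [|d IHd]; first by rewrite add0n.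
    by rewrite addSn big_ord_recr /=; apply: le_trans IHd _; rewrite lerDl relative_weight_ge0.
  have := gt (maxn k l); under eq_bigr => h _ do rewrite relative_weight_split.
  rewrite -mulr_suml big_split /=.
  by have := mono (rcons t false) _ _ (leq_maxl k l);
     have := mono (rcons t true) _ _ (leq_maxr k l); lra.
pose T := fix T n := if n is m.+1 then
  rcons (T m) (if pselect (good (rcons (T m) false)) then false else true) else [::].
have gT n : good (T n).
  by elim: n => //= n IHn; case: pselect => // ?; exact: goodS.
have szT n : size (T n) = n by elim: n => //= n IHn; rewrite size_rcons IHn.
pose x n := nth false (T n.+1) n.
have xT n i : (i < n)%N -> nth false (T n) i = x i.
  elim: n => // n IHn; rewrite ltnS leq_eqVlt => /predU1P[->//|lin].
  by rewrite /= nth_rcons szT lin IHn.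
have [k kx] := sT x I.
have sk : T (size (s k)) = s k.
  apply: (@eq_from_nth _ false); rewrite szT// => i isz.
  by rewrite xT// kx.
have := gT (size (s k)) k.+1; rewrite sk big_ord_recr /= relative_weight_id.
suff : 0 <= \sum_(i < k) relative_weight (s k) (s i) by lra.
by apply: sumr_ge0 => i _; exact: relative_weight_ge0.
Qed.
End NullSets.

(** * The law of large numbers *)

Section Chernoff.
Variable R : realType.
Local Open Scope ring_scope.

(** The factor by which the capital changes when the fraction t is bet on the bit b
    and the outcome is c. *)
Definition bias (t : R) (b c : bool) : R := if c == b then 1 + t else 1 - t.

Lemma prod_bias (t : R) b (x : nat -> bool) (J : seq nat) :
  \prod_(j <- J) bias t b (x j) = (1 + t) ^+ count (fun j => x j == b) J *
    (1 - t) ^+ (size J - count (fun j => x j == b) J).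
Proof.
elim: J => [|j J IHJ] /=; first by rewrite big_nil !expr0 mulr1.
have := count_size (fun j => x j == b) J; rewrite big_cons IHJ /bias; case: (x j == b) => cs.
  by rewrite add1n subSS exprS mulrA.
by rewrite add0n subSn// exprS mulrCA.
Qed.

(** Betting the fraction t of the capital on b at each place of J is a fair
    game. *)
Lemma sum_prod_bias (t : R) b N (P : pred nat) :
  \sum_(f : {ffun 'I_N.+1 -> bool})
    \prod_(j <- [seq j <- iota 0 N.+1 | P j]) bias t b (f (inord j)) = 2 ^+ N.+1.
Proof.
transitivity (\prod_(j : 'I_N.+1) \sum_(c : bool) (if P j then bias t b c else 1)).
  rewrite bigA_distr_bigA; apply: eq_bigr => f _.
  rewrite big_filter -[iota _ _]/(index_iota 0 N.+1) big_mkord big_mkcond /=.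
  by apply: eq_bigr => j _; rewrite inord_val.
rewrite (eq_bigr (fun=> 2)) => [|j _]; first by rewrite prodr_const card_ord.
rewrite big_bool /bias; case: (P j); case: b => /=; lra.
Qed.

(** Raising to the power 2m turns the two bounds on k into powers of the base; taking
    the quotient of n by 2m avoids fractional exponents. *)
Lemma bias_growth (t : R) m n k : 0 <= t < 1 -> (0 < m)%N -> (k <= n)%N ->
  (m.+1 * n <= 2 * m * k)%N -> 1 <= (1 + t) ^+ m.+1 * (1 - t) ^+ m.-1 ->
  ((1 + t) ^+ m.+1 * (1 - t) ^+ m.-1) ^+ (n %/ (2 * m)) <= (1 + t) ^+ k * (1 - t) ^+ (n - k).
Proof.
move=> /andP[t0 t1] m0 kn mk; set C := _ * _ => C1.
have a0 : 0 <= 1 + t by lra. have b0 : 0 <= 1 - t by lra.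
have M0 : (0 < 2 * m)%N by rewrite muln_gt0.
rewrite -(ler_pXn2r M0); last 2 first.
- by rewrite nnegrE exprn_ge0// (le_trans ler01).
- by rewrite nnegrE mulr_ge0// exprn_ge0.
rewrite -exprM; apply: (@le_trans _ _ (C ^+ n)).
  by apply: ler_weXn2l => //; exact: leq_trunc_div.
rewrite /C !exprMn -!exprM; apply: ler_pM; rewrite ?exprn_ge0//.
  by apply: ler_weXn2l; [lra|nia].
by apply: ler_wiXn2l; [lra|lra|nia].
Qed.

Lemma bernoulli_le (u : R) n : 0 <= u <= 1 -> 1 - n%:R * u <= (1 - u) ^+ n.
Proof.
move=> /andP[u0 u1]; elim: n => [|n IHn]; first by rewrite mul0r subr0 expr0.
rewrite exprS -natr1; apply: le_trans (ler_wpM2l _ IHn); last by lra.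
by have : 0 <= n%:R :> R by []; nra.
Qed.

(** Writing t = 1/m, the product is (1+t)^2 (1-t^2)^(m-1), which by the Bernoulli
    inequality is at least (1+t)^2 (1-t+t^2) = (1+t) (1+t^3). *)
Lemma bias_gain m : (1 < m)%N -> let t := m%:R^-1 : R in
  0 <= t < 1 /\ 1 < (1 + t) ^+ m.+1 * (1 - t) ^+ m.-1.
Proof.
case: m => // -[//|m] _ /=; set M := (m.+2)%:R : R.
have M2 : 2 <= M by rewrite /M ler_nat.
have t0 : 0 < M^-1 by rewrite invr_gt0; lra.
have tM : M * M^-1 = 1 by rewrite mulfV//; lra.
set t := M^-1 in t0 tM *; have t1 : t < 1 by nra.
split; first by lra.
have -> : (1 + t) ^+ m.+3 * (1 - t) ^+ m.+1 = (1 + t) ^+ 2 * (1 - t * t) ^+ m.+1.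
  by rewrite -[m.+3]/(2 + m.+1)%N exprD -mulrA -exprMn; congr (_ * _ ^+ _); lra.
apply: (@lt_le_trans _ _ ((1 + t) ^+ 2 * (1 - m.+1%:R * (t * t)))); last first.
  apply: ler_wpM2l; first by rewrite exprn_ge0//; lra.
  by apply: bernoulli_le; apply/andP; split; nra.
have -> : m.+1%:R = M - 1 :> R by rewrite /M -(natr1 m.+1) addrK.
rewrite expr2.
have -> : (M - 1) * (t * t) = t - t * t by rewrite mulrBl mul1r mulrA tM mul1r.
by nra.
Qed.

(** The strings having the bit b on at least the fraction 1/2 + 1/(2m) of the
    positions in J. *)
Definition biased_strings N (J : seq nat) m (b : bool) : seq (seq bool) :=
  [seq mkseq (fun j => f (inord j)) N.+1 | f : {ffun 'I_N.+1 -> bool} <-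
    enum {: {ffun 'I_N.+1 -> bool}} &
    (m.+1 * size J <= 2 * m * count (fun j => f (inord j) == b) J)%N].

(** Markov's inequality for the capital won by betting on b. *)
Lemma weight_biased_strings N (P : pred nat) m b (t := m%:R^-1 : R)
    (J := [seq j <- iota 0 N.+1 | P j]) : (1 < m)%N ->
  weight R (biased_strings N J m b) <=
    ((1 + t) ^+ m.+1 * (1 - t) ^+ m.-1) ^- (size J %/ (2 * m)).
Proof.
move=> m1; have [t01 C1] := bias_gain m1; rewrite -/t in t01 C1.
set C := (1 + t) ^+ m.+1 * (1 - t) ^+ m.-1 in C1 *.
pose Q (f : {ffun 'I_N.+1 -> bool}) :=
  (m.+1 * size J <= 2 * m * count (fun j => f (inord j) == b) J)%N.
rewrite /weight big_map big_filter big_enum_cond /=.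
rewrite (eq_bigr (fun=> 2^-1 ^+ N.+1)) => [|f _]; last by rewrite ?size_mkseq ?size_map ?size_iota.
have t0 : 0 <= 1 + t by lra. have t1 : 0 <= 1 - t by lra.
set e := (_ %/ _)%N; have C0 : 0 < C ^+ e by rewrite exprn_gt0//; lra.
pose X (f : {ffun 'I_N.+1 -> bool}) := \prod_(j <- J) bias t b (f (inord j)).
have X0 f : 0 <= X f.
  by rewrite /X (prod_bias t b (fun j => f (inord j))) mulr_ge0// exprn_ge0.
rewrite -(ler_pM2r C0) mulVf ?gt_eqF// big_distrl /=.
apply: (@le_trans _ _ (\sum_f 2^-1 ^+ N.+1 * X f)); last first.
  by rewrite -mulr_sumr sum_prod_bias -exprMn mulVf// expr1n.
rewrite big_mkcond; apply: ler_sum => f _; case: ifP => [Qf|_]; last first.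
  by rewrite mulr_ge0// exprn_ge0// invr_ge0.
apply: ler_wpM2l; first by rewrite exprn_ge0// invr_ge0.
rewrite /X (prod_bias t b (fun j => f (inord j))).
by apply: bias_growth => //; [lia|exact: count_size|exact: ltW].
Qed.

(** The exponential estimates are summed over batches of M consecutive n, the batches
    being long enough for the measure of the k-th to be at most 2^-k. *)
Lemma biased_null (p q : nat -> nat) m b : cancel p q -> cancel q p -> (1 < m)%N ->
  limsup_null R [set x | forall K, exists2 n, (K <= n)%N &
    (m.+1 * n <= 2 * m * cnt (p @` [set i | x i == b]) n)%N].
Proof.
move=> pq qp m1; have [t01 C1] := bias_gain m1; set t := _^-1 in t01 C1.
set C := _ * _ in C1.
have [r Cr] : exists r, 4 <= C ^+ r.
  have [N Nn] := natr_unbounded (4 / (C - 1)); exists N.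
  have : 1 + N%:R * (C - 1) <= C ^+ N.
    elim: N {Nn} => [|N IHN]; first by rewrite mul0r addr0 expr0.
    rewrite exprS -natr1.
    have d0 : 0 <= C - 1 by lra.
    have d1 : 0 <= N%:R * (C - 1) by rewrite mulr_ge0.
    have d2 : 0 <= (C - 1) * (C ^+ N - 1) by rewrite mulr_ge0//; lra.
    by lra.
  by have := Nn N (leqnn _); rewrite ler_pdivrMr; lra.
have /choice[B qB] n := bounded_preimage q n.
pose J n := [seq j <- iota 0 (B n).+1 | (p j < n)%N].
have qJ n : perm_eq (map q (iota 0 n)) (J n).
  apply: uniq_perm; [by rewrite map_inj_uniq ?iota_uniq//; exact: can_inj qp| |].
    by apply: filter_uniq; exact: iota_uniq.
  move=> j; rewrite mem_filter mem_iota /= add0n; apply/mapP/andP => [[i + ->]|[pj _]].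
    by rewrite mem_iota /= add0n qp => lt; split=> //; have := qB n i lt; lia.
  by exists (p j); rewrite ?pq// mem_iota.
have szJ n : size (J n) = n by rewrite -(perm_size (qJ n)) size_map size_iota.
have cJ (x : nat -> bool) n : count (fun j => x j == b) (J n) =
    cnt (p @` [set i | x i == b]) n.
  rewrite -(seq.permP (qJ n)) count_map (image_can _ pq qp); apply: eq_count => i /=.
  by apply/idP/idP => [h|]; [exact/mem_set|rewrite in_setE].
pose E n := biased_strings (B n) (J n) m b.
pose M := (2 * m * r)%N.
exists (fun k => if (M <= 2 ^ k)%N then flatten [seq E n | n <- iota (M * k) M] else [::]).
split=> [k|x xE K].
  case: ifP => [Mk|_]; last by rewrite /weight big_nil exprn_ge0// invr_ge0.
  rewrite weight_flatten; apply: (@le_trans _ _ (\sum_(n <- iota (M * k) M) 4^-1 ^+ k)).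
    rewrite big_seq [leRHS]big_seq; apply: ler_sum => n; rewrite mem_iota => /andP[Mkn _].
    apply: le_trans (weight_biased_strings _ _ _ m1) _; rewrite -/J szJ -/t -/C exprVn.
    rewrite lef_pV2 ?posrE ?exprn_gt0//; last by lra.
    apply: (@le_trans _ _ (C ^+ (r * k))).
      by rewrite exprM; apply: lerXn2r; rewrite ?nnegrE; lra.
    apply: ler_weXn2l; first exact: ltW.
    by rewrite leq_divRL; [rewrite mulnC mulnA|lia].
  rewrite big_const_seq count_predT size_iota iter_addr_0 -[_ *+ M]mulr_natr.
  have -> : 4^-1 = 2^-1 * 2^-1 :> R by lra.
  rewrite exprMn -mulrA ler_piMr ?exprn_ge0 ?invr_ge0//.
  by rewrite exprVn mulrC ler_pdivrMr ?exprn_gt0// mul1r -natrX ler_nat.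
have M0 : (0 < M)%N.
  rewrite /M !muln_gt0 /=; apply/andP; split; first by lia.
  by case: r Cr @M => //; rewrite expr0; lra.
have [n Kn xn] := xE (M * (K + M))%N.
have Kd : (K + M <= n %/ M)%N by rewrite leq_divRL// mulnC.
exists (n %/ M)%N; first by lia.
have -> : (M <= 2 ^ (n %/ M))%N.
  by apply: leq_trans (_ : n %/ M <= _)%N; [lia|rewrite ltnW// ltn_expl].
exists (mkseq x (B n).+1); last by move=> i; rewrite size_mkseq => lt; rewrite nth_mkseq.
apply/flatten_mapP; exists n.
  by rewrite mem_iota -mulnSr mulnC leq_trunc_div /= mulnC ltn_ceil.
apply/mapP; exists [ffun j : 'I_(B n).+1 => x j].
  rewrite mem_filter mem_enum andbT szJ.
  rewrite (@eq_in_count _ _ (fun j => x j == b)) ?cJ// => j.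
  by rewrite mem_filter mem_iota => /andP[_ /andP[_ jB]]; rewrite ffunE inordK.
apply: (@eq_from_nth _ false); rewrite !size_mkseq// => i lt.
by rewrite !nth_mkseq// ffunE inordK.
Qed.

(** For each m, almost surely, both bits stay below the fraction 1/2 + 1/(2m) from
    some point on. *)
Lemma large_numbers (p : nat -> nat) : bijective p ->
  limsup_null R [set x | ~ has_density (p @` [set i | x i]) (2^-1 : R)].
Proof.
move=> [q pq qp].
have := limsup_null_bigcup (fun m =>
  @biased_null p q (m./2.+2) (odd m) pq qp (erefl : (1 < m./2.+2)%N)).
apply: limsup_nullS => x nx; apply: contrapT => H; apply: nx.
have xb m b : exists K, forall n, (K <= n)%N ->
    (2 * m.+2 * cnt (p @` [set i | x i == b]) n <= m.+3 * n)%N.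
  apply: contrapT => nK; apply: H; exists (b + m.*2)%N => //=.
  rewrite half_bit_double oddD odd_double addbF oddb => K.
  apply: contrapT => Kn; apply: nK; exists K => n Kn'.
  by rewrite leqNgt; apply/negP => /ltnW lt; apply: Kn; exists n.
move=> e e0; have [m me] := natr_unbounded e^-1.
have [K1 HK1] := xb m true; have [K2 HK2] := xb m false.
exists (maxn K1 K2) => n; rewrite geq_max => /andP[/HK1 + /HK2].
have -> : [set i | x i == true] = [set i | x i].
  by apply/seteqP; split=> i /=; case: (x i).
have -> : p @` [set i | x i == false] = ~` (p @` [set i | x i]).
  rewrite -image_setC; last by exists q.
  by congr image; apply/seteqP; split=> i /=; case: (x i).
rewrite -!(ler_nat R) !natrM natr_cntC.
have : e^-1 <= m%:R by exact: me.
have -> : m.+3%:R = m%:R + 3 :> R by rewrite -addn3 natrD.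
have -> : m.+2%:R = m%:R + 2 :> R by rewrite -addn2 natrD.
rewrite -div1r ler_pdivrMr// ler_norml.
have : 0 <= n%:R :> R by []. have : 0 <= m%:R :> R by [].
move: m%:R n%:R (cnt _ n)%:R => M N c M0 N0 Me h1 h2.
have e1 : N <= M * e * N by nra.
have M2 : 0 < M + 2 by lra.
apply/andP; split; rewrite -(ler_pM2l M2); nra.
Qed.
End Chernoff.

(** * Alternating permutations, and the theorem *)

Section Alternation.
Variables p q : nat -> nat.
Hypotheses (pq : cancel p q) (qp : cancel q p).

(** The stages exhaust nat by finite sets that are in turn preimages of initial
    segments under p and initial segments. *)
Definition stage k m : seq nat := if odd k then map q (iota 0 m) else iota 0 m.

Definition stage_bound (l : seq nat) := (sumn l + sumn (map p l) + size l).+1.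

(** The new elements of each stage are appended, so that the position of an element
    never changes. *)
Definition listing := fix listing k := if k is l.+1 then
  listing l ++ [seq i <- stage l (stage_bound (listing l)) | i \notin listing l] else [::].

Lemma stage_uniq k m : uniq (stage k m).
Proof.
by rewrite /stage; case: odd; rewrite ?map_inj_uniq ?iota_uniq//; exact: can_inj qp.
Qed.

Lemma listing_uniq k : uniq (listing k).
Proof.
elim: k => //= k IHk; rewrite cat_uniq IHk filter_uniq ?stage_uniq// andbT.
by apply/hasPn => i; rewrite mem_filter => /andP[].
Qed.

Lemma listing_sub_stage k : {subset listing k <= stage k (stage_bound (listing k))}.
Proof.
move=> i il; rewrite /stage; have [_|_] := boolP (odd k).
  apply/mapP; exists (p i); rewrite ?pq// mem_iota /= add0n /stage_bound.
  have pil : p i \in map p (listing k) by exact: map_f.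
  by rewrite [sumn (map _ _)]sumnE (big_rem _ pil) /=; lia.
by rewrite mem_iota /= add0n /stage_bound sumnE (big_rem _ il) /=; lia.
Qed.

Lemma listing_stage k : perm_eq (listing k.+1) (stage k (stage_bound (listing k))).
Proof.
apply: uniq_perm; [exact: listing_uniq|exact: stage_uniq|move=> i].
rewrite mem_cat mem_filter; have [il|_] //= := boolP (i \in listing k).
by rewrite (listing_sub_stage il).
Qed.

Lemma size_listing k : size (listing k.+1) = stage_bound (listing k).
Proof.
rewrite (perm_size (listing_stage k)) /stage.
by case: odd; rewrite ?size_map size_iota.
Qed.

Lemma size_listing_ge k : k <= size (listing k).
Proof. by elim: k => // k IHk; rewrite size_listing ltnS (leq_trans IHk)// leq_addl. Qed.

Lemma listing_prefix k l : k <= l -> exists G, listing l = listing k ++ G.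
Proof.
move=> kl; rewrite -(subnK kl); elim: (l - k) => [|d [G E]].
  by exists [::]; rewrite add0n cats0.
rewrite addSn /= {1}E -catA.
by exists (G ++ [seq i <- stage (d + k) (stage_bound (listing (d + k))) |
  i \notin listing (d + k)]).
Qed.

Lemma mem_listing i : i \in listing i.*2.+1.
Proof.
rewrite (perm_mem (listing_stage _)) /stage odd_double mem_iota /= add0n ltnS.
apply: leq_trans (leq_addl _ _); apply: leq_trans (size_listing_ge _).
by rewrite -addnn leq_addr.
Qed.

Definition listed i := nth 0 (listing i.+1) i.
Definition alternation a := index a (listing a.*2.+1).

Lemma listedE k i : i < size (listing k) -> listed i = nth 0 (listing k) i.
Proof.
move=> ik; rewrite /listed.
have [lt|/ltnW le] := leqP i.+1 k.
  have [G ->] := listing_prefix lt.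
  by rewrite [RHS]nth_cat (leq_trans _ (size_listing_ge i.+1)).
by have [G ->] := listing_prefix le; rewrite [LHS]nth_cat ik.
Qed.

Lemma alternationE k a : a \in listing k -> alternation a = index a (listing k).
Proof.
move=> ak; rewrite /alternation.
have [le|/ltnW le] := leqP k a.*2.+1.
  by have [G ->] := listing_prefix le; rewrite [LHS]index_cat ak.
by have [G ->] := listing_prefix le; rewrite [RHS]index_cat mem_listing.
Qed.

Lemma alternationK : cancel alternation listed.
Proof.
move=> a; rewrite (@listedE a.*2.+1) /alternation ?index_mem ?mem_listing//.
by rewrite nth_index// mem_listing.
Qed.

Lemma listedK : cancel listed alternation.
Proof.
move=> i; have isz := size_listing_ge i.+1.
by rewrite (@alternationE i.+1) /listed ?mem_nth// index_uniq// listing_uniq.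
Qed.

(** The first elements of the listing, as many as there are in a stage, are exactly
    this stage. *)
Lemma cnt_alternation (A : set nat) k (m := stage_bound (listing k)) :
  cnt (alternation @` A) m = if odd k then cnt (p @` A) m else cnt A m.
Proof.
rewrite (image_can _ alternationK listedK) (image_can _ pq qp).
have c (f : nat -> nat) n : cnt (f @^-1` A) n = count (fun i => i \in A) (map f (iota 0 n)).
  rewrite count_map; apply: eq_count => i /=.
  by apply/idP/idP => /set_mem h; exact/mem_set.
have -> : cnt (listed @^-1` A) m = count (fun i => i \in A) (stage k m).
  rewrite -(seq.permP (listing_stage k)) c; congr count.
  have sz := size_listing k; rewrite -/m in sz.
  apply: (@eq_from_nth _ 0) => [|i]; rewrite size_map size_iota ?sz// => im.
  by rewrite (nth_map 0) ?size_iota// nth_iota// add0n (@listedE k.+1)// sz.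
by rewrite /stage; case: (odd k); [rewrite c|].
Qed.
End Alternation.

Section Final.
Variable R : realType.
Implicit Types P : set (nat -> nat).

(** Along the even stages the frequencies of the image are those of A, along the odd
    ones those of its image under p. *)
Lemma alternation_osc (p q : nat -> nat) (A : set nat) (x y : R) :
  cancel p q -> cancel q p -> has_density A x -> has_density (p @` A) y -> x <> y ->
  density R (alternation p q @` A) = osc R.
Proof.
move=> pq qp Ax Ay xy; apply/density_oscP => z Az; apply: xy.
have size_ge k : k <= stage_bound p (listing p q k).
  by rewrite -(size_listing pq qp) ltnW//; exact: (size_listing_ge pq qp k.+1).
transitivity z; [apply/esym|]; apply: (has_density_sample Az) => e K e0.
  have [L HL] := Ax e e0; pose k := (maxn K L).*2.
  have [Kk Lk] : K <= k /\ L <= k by rewrite /k; split; lia.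
  exists (stage_bound p (listing p q k)); first exact: leq_trans (size_ge k).
  by rewrite cnt_alternation// odd_double HL// (leq_trans Lk).
have [L HL] := Ay e e0; pose k := (maxn K L).*2.+1.
have [Kk Lk] : K <= k /\ L <= k by rewrite /k; split; lia.
exists (stage_bound p (listing p q k)); first exact: leq_trans (size_ge k).
by rewrite cnt_alternation// /k oddS odd_double /= -/k HL// (leq_trans Lk).
Qed.

Definition not_halved (p : nat -> nat) (x : nat -> bool) : Prop :=
  ~ has_density (p @` [set i | x i]) (2^-1 : R)%R \/
  ~ has_density [set i | x i] (2^-1 : R)%R.

(** The large numbers law, for p and for the identity. *)
Lemma not_halved_null p : bijective p -> limsup_null R [set x | not_halved p x].
Proof.
move=> bp; have bid : bijective (@id nat) by exists id.
apply: limsup_nullS (limsup_nullU (large_numbers R bp) (large_numbers R bid)) => x.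
by move=> [px|x0]; [left|right; rewrite /= image_id].
Qed.

Lemma not_halved_cover P : witness (Ioo01 R) (all_densities R) P ->
  forall x, exists2 p, P p & not_halved p x.
Proof.
move=> [Psym PP] x.
have H A : has_density A (2^-1 : R)%R -> exists2 p, P p & ~ has_density (p @` A) (2^-1 : R)%R.
  move=> dA; have [iA iA'] : moiety A by apply: has_density_moiety dA _; lra.
  have {}dA : density R A = Some 2^-1%R by apply/densityP.
  have [|p Pp [_ np]] := PP A iA iA'; first by rewrite dA; exact: half_Ioo01.
  by exists p => // /densityP pd; apply: np; rewrite pd dA.
have [/H[p Pp np]|nx] := pselect (has_density [set i | x i] (2^-1 : R)%R).
  by exists p => //; left.
have [|A mA /H[p Pp _]] := @density_realized R 2^-1%R; first by lra.
by exists p => //; right.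
Qed.

(** If all the sets [not_halved p] missed some x, then x would have density 1/2 and P
    would not change it. *)
Lemma cov_null_le P : witness (Ioo01 R) (all_densities R) P ->
  (cov (null R) <= Defs.card P)%O.
Proof.
move=> wP; apply: (least_size_le (F := (not_halved : _ -> (nat -> bool) -> Prop) @` P)); last first.
  rewrite -[X in (X <= _)%O]/(@Defs.card ((nat -> bool) -> Prop) (not_halved @` P)).
  exact: card_image_leq.
split=> [_ [p Pp <-]|].
  by apply: limsup_null_null; apply: not_halved_null; exact: wP.1.
apply/seteqP; split=> // x _; have [p Pp px] := not_halved_cover wP x.
by exists (not_halved p) => //; exists p.
Qed.

(** Countably many null sets do not cover the space. *)
Lemma Ioo01_witness_infinite P : witness (Ioo01 R) (all_densities R) P -> infinite_set P.
Proof.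
move=> wP /finite_set_countable/countable_injP[e eI]; apply: (@limsup_null_setT R).
pose A m := [set x | exists p, [/\ P p, e p = m & not_halved p x]].
apply: (@limsup_nullS _ _ (\bigcup_m A m)).
  by move=> x _; have [p Pp px] := not_halved_cover wP x; exists (e p) => //; exists p.
apply: limsup_null_bigcup => m.
have [[p [Pp pm]]|np] := pselect (exists p, P p /\ e p = m).
  apply: limsup_nullS (not_halved_null (wP.1 _ Pp)) => x [p' [Pp' pm' px]].
  by have -> : p = p' by apply: eI; rewrite ?inE// pm.
exists (fun=> [::]); split=> [n|x [p [Pp pm _]]]; last by case: np; exists p.
by rewrite /weight big_nil exprn_ge0// invr_ge0.
Qed.

Lemma dd_defined_Ioo Y : Y `<=` all_densities R ->
  (exists2 d, Y d & forall r, Ioo01 R r -> d <> r) ->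
  dd_defined (Ioo01 R) Y.
Proof.
move=> Yall [d Yd nd]; split=> //; first by move=> x /Ioo01_Icc01/Icc01_all.
  by exists (Some 2^-1)%R; exact: half_Ioo01.
by move=> x /nd; exists d.
Qed.

Lemma dd_defined_Ioo_osc : dd_defined (Ioo01 R) [set osc R].
Proof.
apply: dd_defined_Ioo => [_ ->|]; first by right.
by exists (osc R) => // r /Ioo01_Icc01 + or; rewrite -or; exact: Icc01_osc.
Qed.

Lemma dd_defined_Ioo_all : dd_defined (Ioo01 R) (all_densities R).
Proof.
apply: dd_defined_Ioo => //.
by exists (osc R); [right|move=> r /Ioo01_Icc01 + or; rewrite -or; exact: Icc01_osc].
Qed.

Lemma dd_defined_Ioo_ends : dd_defined (Ioo01 R) (ends01 R).
Proof.
apply: dd_defined_Ioo => [d /ends01_Icc01/Icc01_all//|].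
exists (Some 0%R) => [|_ [r + <-] [r0]]; first by left.
by rewrite /= in_itv /= -r0 ltxx.
Qed.

Lemma dd_defined_Ioo_Ioo : dd_defined (Ioo01 R) (Ioo01 R).
Proof.
split=> [d /Ioo01_Icc01/Icc01_all//|d /Ioo01_Icc01/Icc01_all//||_ [r + <-]].
  by exists (Some 2^-1)%R; exact: half_Ioo01.
rewrite /= in_itv /= => /andP[r0 r1].
by exists (Some (r / 2))%R; [apply/in_Ioo01; lra|move=> []; lra].
Qed.

(** When p changes a density to another real number, the alternation of p makes the set
    oscillate; the alternations are added to P, which does not increase the size of P
    because P is infinite. *)
Lemma dd_Ioo_osc : dd (Ioo01 R) (all_densities R) = dd (Ioo01 R) [set osc R].
Proof.
apply: le_anti; apply/andP; split.
  by apply: dd_subset => // [_ ->|]; [right|exact: dd_defined_Ioo_osc].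
have [P wP <-] := dd_attained dd_defined_Ioo_all.
have iP := Ioo01_witness_infinite wP; have [Psym PP] := wP.
have /choice[q qP] p : exists q, P p -> cancel p q /\ cancel q p.
  have [/Psym[q pq qp]|nP] := pselect (P p); first by exists q.
  by exists id => /nP.
pose Q := P `|` (fun p => alternation p (q p)) @` P.
apply: (@dd_le _ _ _ Q); last first.
  by rewrite cardinal_leE; apply: card_setU_le => //; exact: card_image_le.
split=> [p [/Psym//|[{}p Pp <-]]|A iA iA' XA].
  by have [pq qp] := qP p Pp; exists (listed p (q p)); [exact: alternationK|exact: listedK].
have [p Pp [_ np]] := PP A iA iA' XA.
have no : osc R <> density R A by move=> oA; apply: (@Icc01_osc R); rewrite oA; exact: Ioo01_Icc01.
case pA : (density R (p @` A)) np => [y|] np; last first.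
  by exists p; [left|rewrite pA; split].
exists (alternation p (q p)); first by right; exists p.
suff -> : density R (alternation p (q p) @` A) = osc R by [].
case: XA => x _ xA; have [pq qp] := qP p Pp.
apply: (@alternation_osc _ _ _ x y) => //; [exact/densityP|exact/densityP|].
by move=> xy; apply: np; rewrite -xA xy.
Qed.

Lemma dd_defined_Icc_all : dd_defined (Icc01 R) (all_densities R).
Proof.
split=> //; first by exists (Some 0%R); apply: ends01_Icc01; left.
by move=> d Xd; exists (osc R); [right|move=> od; apply: (@Icc01_osc R); rewrite od].
Qed.

Lemma dd_defined_ends_all : dd_defined (ends01 R) (all_densities R).
Proof.
split=> [d /ends01_Icc01/Icc01_all//|//||d Xd]; first by exists (Some 0%R); left.
by exists (osc R); [right|move=> od; apply: (@Icc01_osc R); rewrite od; exact: ends01_Icc01].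
Qed.

Lemma dd_defined_all_all : dd_defined (all_densities R) (all_densities R).
Proof.
split=> //; first by exists (osc R); right.
move=> d [Xd|->]; first by have [_ _ _ /(_ d Xd)] := dd_defined_Icc_all.
by exists (Some 0%R) => //; left; apply: ends01_Icc01; left.
Qed.

Lemma dd_defined_osc Y : Y `<=` all_densities R -> Y (Some 0%R) -> dd_defined [set osc R] Y.
Proof.
move=> Yall Y0; split=> // [_ ->||_ ->]; [by right|by exists (osc R)|].
by exists (Some 0%R).
Qed.

(** One family takes care of the real densities, another one of the oscillating sets.
    One of the two bounds is infinite, since countable sets are meager. *)
Lemma dd_all_le : (dd (all_densities R) (all_densities R) <=
  Order.max (non meager) (dd [set osc R] (all_densities R)))%O.
Proof.
have [P1 [P1sym w1] c1] := dd_attained dd_defined_Icc_all.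
have [P2 [P2sym w2] <-] := dd_attained (dd_defined_osc_all R).
have le1 : (Defs.card P1 <= non meager)%O by rewrite c1; apply: dd_le_non_meager; right.
have [S nS ScE] : exists2 S : set (nat -> bool), ~ meager S & Defs.card S = non meager.
  have [|S nS SE] := @least_size_attained _ [set S : set cantor_space | ~ meager S].
    by exists setT; exact: not_meager_setT.
  by exists S.
have iS : infinite_set S by move=> /finite_set_countable/countable_meager.
apply: (@dd_le _ _ _ (P1 `|` P2)).
  split=> [p [/P1sym|/P2sym]//|A iA iA' [XA|XA]].
    by have [p Pp pA] := w1 A iA iA' XA; exists p => //; left.
  by have [p Pp pA] := w2 A iA iA' XA; exists p => //; right.
have [SP2|P2S] := orP (le_total (Defs.card S) (Defs.card P2)).
  rewrite -ScE (max_idPr SP2); rewrite -ScE in le1.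
  have iP2 : infinite_set P2.
    by move: SP2; rewrite cardinal_leE => /card_le_finite fin /fin.
  move: (le_trans le1 SP2); rewrite !cardinal_leE => le2.
  by apply: card_setU_le iP2 le2 _; exact: card_lexx.
rewrite -ScE (max_idPl P2S); rewrite -ScE in le1.
by move: le1 P2S; rewrite !cardinal_leE; exact: card_setU_le.
Qed.
End Final.

Local Open Scope order_scope.

Theorem corollary30 (R : realType) :
  (* 1 *)
  (forall Y : set (option R),
    dd_defined (Icc01 R) Y -> dd_defined (ends01 R) Y ->
    Y (osc R) ->
    dd (Icc01 R) Y = dd (ends01 R) Y /\ dd (ends01 R) Y = non meager) /\
  (* 2 *)
  ((forall Y : set (option R),
     dd_defined (all_densities R) Y -> dd_defined (Icc01 R) Y ->
     dd_defined (ends01 R) Y ->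
     ~ Y (osc R) ->
     [/\ dd (all_densities R) Y = dd (Icc01 R) Y,
         dd (Icc01 R) Y = dd (ends01 R) Y &
         dd (ends01 R) Y = continuum]) /\
   dd [set osc R] (Ioo01 R) = continuum) /\
  (* 3 *)
  [/\ cov (null R) <= dd (Ioo01 R) (all_densities R),
      dd (Ioo01 R) (all_densities R) = dd (Ioo01 R) [set osc R] &
      dd (Ioo01 R) [set osc R] <= Order.min reaping_number (non meager)] /\
  (* 4 *)
  [/\ Order.max (Order.max (cov (null R)) (cov meager)) unbounding_number
        <= dd (Ioo01 R) (Icc01 R),
      dd (Ioo01 R) (Icc01 R) <= dd (Ioo01 R) (Ioo01 R),
      dd (Ioo01 R) (Ioo01 R) <= reaping_number,
      dd (Ioo01 R) (Icc01 R) <= dd (Ioo01 R) (ends01 R) &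
      dd (Ioo01 R) (ends01 R) <= reaping_number] /\
  (* 5 *)
  [/\ Order.max unbounding_number (cov meager)
        <= dd [set osc R] (all_densities R),
      dd [set osc R] (all_densities R) = dd [set osc R] (Icc01 R),
      dd [set osc R] (Icc01 R) <= dd [set osc R] (ends01 R) &
      dd [set osc R] (ends01 R) <= reaping_number] /\
  (* 6 *)
  [/\ Order.max (non meager) (cov meager)
        <= dd (all_densities R) (all_densities R),
      dd (all_densities R) (all_densities R) =
        Order.max (non meager) (dd [set osc R] (all_densities R)) &
      Order.max (non meager) (dd [set osc R] (all_densities R))
        <= Order.max (non meager) reaping_number].
Proof.
have dOA := dd_defined_Ioo_all R; have dOO := dd_defined_Ioo_osc R.
have dOI := dd_defined_Ioo01_Icc01 R; have dSA := dd_defined_osc_all R.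
have Z : Icc01 R (Some 0%R) by apply: ends01_Icc01; left.
have dSI : dd_defined [set osc R] (Icc01 R) by apply: dd_defined_osc.
have dSE : dd_defined [set osc R] (ends01 R).
  by apply: dd_defined_osc => [d /ends01_Icc01/Icc01_all|] //; left.
have dII : dd_defined (Icc01 R) [set osc R].
  split=> // [_ ->||d Xd]; [by right|by exists (Some 0%R)|].
  by exists (osc R) => // od; apply: (@Icc01_osc R); rewrite od.
have ends_non Y : dd_defined (ends01 R) Y -> non meager <= dd (ends01 R) Y.
  by move=> d; apply: dd_ge d _ => P; exact: non_meager_le_witness.
have oscA : [set osc R] `<=` all_densities R by move=> _ ->; right.
have nE d : ends01 R d -> forall r, Ioo01 R r -> d <> r.
  by move=> [->|->] _ [r + <-] [e]; rewrite /= in_itv /= -e ltxx ?andbF.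
have osc_reaping : dd [set osc R] (ends01 R) <= reaping_number.
  by apply: dd_ends_le_reaping => _ -> /ends01_Icc01; exact: Icc01_osc.
have Ioo_reaping := dd_Ioo_le_reaping R.
have sampled P : witness (Ioo01 R) (Icc01 R) P ->
    cov meager <= Defs.card P /\ unbounding_number <= Defs.card P.
  move=> /Ioo01_witness_nonstretchy[F PF].
  by split; [exact: cov_meager_le PF|exact: unbounding_number_le PF].
have sampled' P : witness [set osc R] (all_densities R) P ->
    cov meager <= Defs.card P /\ unbounding_number <= Defs.card P.
  move=> /osc_witness_nonstretchy[F PF].
  by split; [exact: cov_meager_le PF|exact: unbounding_number_le PF].
have covN : cov (null R) <= dd (Ioo01 R) (all_densities R).
  by apply: dd_ge dOA _ => P; exact: cov_null_le.
have osc_eq : dd [set osc R] (all_densities R) = dd [set osc R] (Icc01 R).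
  apply: le_anti; apply/andP; split; first by apply: dd_subset.
  by apply: dd_mono => // _ y -> [//|->].
have osc_le : dd [set osc R] (Icc01 R) <= dd [set osc R] (ends01 R).
  by apply: dd_subset => //; exact: ends01_Icc01.
have max_osc : dd [set osc R] (all_densities R) <= dd (all_densities R) (all_densities R).
  by apply: dd_subset => //; exact: dd_defined_all_all.
have max_non : non meager <= dd (all_densities R) (all_densities R).
  apply: le_trans (ends_non _ (dd_defined_ends_all R)) _.
  apply: dd_subset => //; last exact: dd_defined_all_all.
  by move=> d /ends01_Icc01/Icc01_all.
have lower5 : Order.max unbounding_number (cov meager) <= dd [set osc R] (all_densities R).
  by rewrite ge_max; apply/andP; split; apply: dd_ge dSA _ => P /sampled'[].
split; [|split; [split|split; [|split; [|split]]]].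
- move=> Y dI dE Yo; have le1 : dd (ends01 R) Y <= dd (Icc01 R) Y.
    by apply: dd_subset => //; exact: ends01_Icc01.
  have le2 := dd_le_non_meager Yo; have le3 := ends_non _ dE.
  have e2 : dd (ends01 R) Y = non meager.
    by apply: le_anti; rewrite le3 (le_trans le1 le2).
  by split=> //; apply: le_anti; rewrite le1 e2 le2.
- move=> Y dA dI dE nY; have le1 : dd (ends01 R) Y <= dd (Icc01 R) Y.
    by apply: dd_subset => //; exact: ends01_Icc01.
  have le2 : dd (Icc01 R) Y <= dd (all_densities R) Y by apply: dd_subset.
  have le3 := dd_le_continuum dA; have le4 := dd_ends_continuum dE nY.
  have c1 : dd (ends01 R) Y = continuum.
    by apply: le_anti; rewrite le4 (le_trans le1 (le_trans le2 le3)).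
  have c2 : dd (Icc01 R) Y = continuum.
    by apply: le_anti; rewrite (le_trans le2 le3) (le_trans le4 le1).
  split=> //; last by rewrite c2.
  by rewrite c2; apply: le_anti; rewrite le3 (le_trans le4 (le_trans le1 le2)).
- exact: dd_osc_continuum.
- split=> //; first exact: dd_Ioo_osc.
  rewrite le_min; apply/andP; split.
    rewrite -dd_Ioo_osc; apply: le_trans Ioo_reaping.
    by apply: dd_subset => [//|d /Ioo01_Icc01/Icc01_all//|]; exact: dd_defined_Ioo_Ioo.
  apply: (@le_trans _ _ (dd (Icc01 R) [set osc R])); last exact: dd_le_non_meager.
  by apply: dd_subset => //; exact: Ioo01_Icc01.
- split.
  + rewrite ge_max; apply/andP; split; last by apply: dd_ge dOI _ => P /sampled[].
    rewrite ge_max; apply/andP; split; last by apply: dd_ge dOI _ => P /sampled[].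
    by apply: le_trans covN _; apply: dd_subset.
  + by apply: dd_subset => [//||]; [exact: Ioo01_Icc01|exact: dd_defined_Ioo_Ioo].
  + exact: Ioo_reaping.
  + by apply: dd_subset => [//||]; [exact: ends01_Icc01|exact: dd_defined_Ioo_ends].
  + by apply: dd_ends_le_reaping => d Xd Ed; exact: (nE d Ed d Xd).
- by split.
- split.
  + rewrite ge_max max_non /=; apply: le_trans max_osc.
    by move: lower5; rewrite ge_max => /andP[].
  + apply: le_anti; rewrite dd_all_le /= ge_max max_non; exact: max_osc.
  + rewrite ge_max !le_max lexx /=; apply/orP; right.
    by rewrite osc_eq (le_trans osc_le).
Qed.
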